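(* (i) For $\tau,\eta\in\mathcal{OP}_n$ the Goldberg coefficient $g(\tau,\eta)$ equals $$g(\tau,\eta)=\begin{cases}\displaystyle\frac1{q_1!q_2!\cdots q_r!}\int_{-1}^0x^{\mathrm{des}_\eta(\tau)}(1+x)^{\mathrm{asc}_\eta(\tau)}\prod_{j=1}^rP_{q_j}(x)\,dx,&\bar\tau\le\bar\eta,\\[2mm]0,&\bar\tau\not\le\bar\eta,\end{cases}$$ where $q_1,\dots,q_r$ are the lengths of the level runs of the sequence $(m_i)_{i=1}^{|\tau|}$ associated with $(\tau,\eta)$ (see context), and $$P_q(x)=\sum_{k=1}^qk!\,S(q,k)\,x^{k-1}=E_q(x,x+1),$$ $S(q,k)$ being the Stirling numbers of the second kind and $E_n(x,y)=\sum_{\sigma\in\mathfrak S_n}x^{\mathrm{des}\,\sigma}y^{\mathrm{asc}\,\sigma}$ the homogeneous Eulerian polynomials. (ii) For $\tau,\eta,\pi\in\mathcal{OP}_n$ the partitioned Goldberg coefficient is $$g(\tau,\eta,\pi)=\begin{cases}\displaystyle\prod_{P\in\pi}g(\tau\rfloor_P,\eta\rfloor_P),&\bar\tau\le\bar\eta\text{ and }\tau\le\pi,\\0,&\text{otherwise.}\end{cases}$$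
   Context: Ordered set partitions. $[n]=\{1,\dots,n\}$. An ordered set partition of a finite set $A$ is a sequence $\pi=(P_1,\dots,P_p)$ of pairwise disjoint nonempty blocks with union $A$; $|\pi|=p$; $\mathcal{OP}_A$ is the set of them, $\mathcal{OP}_n=\mathcal{OP}_{[n]}$, and $\hat1_n=([n])$; $\bar\pi$ is the underlying set partition; set partitions are ordered by refinement. For $\pi=(P_1,\dots,P_p)$, $\sigma=(S_1,\dots,S_s)$ we write $\pi\le\sigma$ iff $\bar\pi\le\bar\sigma$ and, whenever $i<j$, $P_i\subseteq S_k$, $P_j\subseteq S_l$, one has $k\le l$. The quasi-meet is $\pi\curlywedge\sigma=(P_1\cap S_1,P_1\cap S_2,\dots,P_1\cap S_s,P_2\cap S_1,\dots,P_p\cap S_s)$ with empty sets removed. For nonempty $P\subseteq[n]$, $\sigma\rfloor_P\in\mathcal{OP}_P$ is $(P\cap S_1,\dots,P\cap S_s)$ with empty sets removed, and $\#(\sigma\rfloor_P)$ is its number of blocks. For $\sigma\le\pi$: $\widetilde\zeta(\sigma,\pi)=1/\prod_{P\in\pi}\#(\sigma\rfloor_P)!$ and $\widetilde\mu(\sigma,\pi)=(-1)^{|\sigma|-|\pi|}/\prod_{P\in\pi}\#(\sigma\rfloor_P)$. Weisner and Goldberg coefficients. For $\tau,\eta,\pi\in\mathcal{OP}_n$, $$w(\tau,\eta)=\sum_{\sigma\in\mathcal{OP}_n,\ \sigma\curlywedge\eta=\tau}\widetilde\mu(\sigma,\hat1_n),\qquad g(\tau,\eta)=\sum_{\sigma\in\mathcal{OP}_n,\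 \sigma\ge\tau}\widetilde\zeta(\tau,\sigma)\,w(\sigma,\eta),$$ $$w(\tau,\eta,\pi)=\sum_{\sigma\in\mathcal{OP}_n,\ \sigma\curlywedge\eta=\tau,\ \sigma\le\pi}\widetilde\mu(\sigma,\pi),\qquad g(\tau,\eta,\pi)=\sum_{\sigma\in\mathcal{OP}_n,\ \sigma\ge\tau}\widetilde\zeta(\tau,\sigma)\,w(\sigma,\eta,\pi).$$ For ordered set partitions of a finite set $P$ in place of $[n]$, $g(\tau,\eta)$ is defined by the same formulas with $\mathcal{OP}_P$ and the one-block partition $(P)$. Statistics. Let $\tau=(T_1,\dots,T_s)$, $\eta=(E_1,\dots,E_e)\in\mathcal{OP}_n$ with $\bar\tau\le\bar\eta$. Let $m_i\in[e]$ be the index with $T_i\subseteq E_{m_i}$. Then $\mathrm{des}_\eta(\tau)=\#\{i\in[s-1]:m_i>m_{i+1}\}$ and $\mathrm{asc}_\eta(\tau)=\#\{i\in[s-1]:m_i<m_{i+1}\}$. A level run is a maximal contiguous subsequence of $(m_i)_{i=1}^s$ with all entries equal; the sequence decomposes uniquely into level runs, and $r$ is their number, $q_1,\dots,q_r$ their lengths in order of appearance. For a permutation $\sigma\in\mathfrak S_n$, $\mathrm{des}\,\sigma=\#\{i\in[n-1]:\sigma(i)>\sigma(i+1)\}$ and $\mathrm{asc}\,\sigma=\#\{i\in[n-1]:\sigma(i)<\sigma(i+1)\}$. *)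

(* Defs.v *)
From HB Require Import structures.
From mathcomp Require Import all_boot all_order all_algebra all_fingroup.

Set Implicit Arguments.
Unset Strict Implicit.
Unset Printing Implicit Defensive.

Import GRing.Theory.
Local Open Scope ring_scope.

Section OrderedSetPartitions.
Variable T : finType.
Implicit Types (A P : {set T}) (s t p e : seq {set T}).

Definition is_osp A s : bool :=
  [&& set0 \notin s, pairwise (fun P Q => [disjoint P & Q]) s
    & \bigcup_(P <- s) P == A].

Lemma is_osp_size A s : is_osp A s -> (size s <= #|A|)%N.
Proof.
move=> /and3P[]; elim: s A => [|P s IH] A //=.
rewrite inE negb_or => /andP[P0 s0] /andP[Ps dis]; rewrite big_cons => /eqP <-.
rewrite cardsU disjoint_setI0 ?cards0 ?subn0.
  have P1 : (0 < #|P|)%N by rewrite card_gt0 eq_sym.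
  by rewrite -add1n leq_add // (IH _ s0 dis).
rewrite -setI_eq0 big_seq big_distrr /=; apply/eqP/big1 => B Bs.
by apply/eqP; rewrite setI_eq0 (allP Ps).
Qed.

(* The ordered set partitions of A. The length bound carried by [bseq] only
   serves to make the type finite; it is automatic by [is_osp_size]. *)
Record OP A := OrdSetPart {
  op_blocks :> #|A|.-bseq {set T};
  op_blocksP : is_osp A op_blocks }.

HB.instance Definition _ A := [isSub for @op_blocks A].
HB.instance Definition _ A := [Finite of OP A by <:].

Lemma exists_OP A s : is_osp A s -> exists pi : OP A, pi = s :> seq {set T}.
Proof.
move=> sP; pose b : #|A|.-bseq {set T} := Bseq (is_osp_size sP).
by exists (@OrdSetPart A b sP).
Qed.

Definition underlying s : {set {set T}} := [set P in s].

Definition refines (p q : {set {set T}}) : bool :=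
  [forall P in p, exists Q in q, P \subset Q].

Definition op_le p s : bool :=
  refines (underlying p) (underlying s) &&
  [forall i : 'I_(size p), forall j : 'I_(size p),
   forall k : 'I_(size s), forall l : 'I_(size s),
     [&& (i < j)%N, nth set0 p i \subset nth set0 s k
       & nth set0 p j \subset nth set0 s l] ==> (k <= l)%N].

Definition qmeet p s : seq {set T} :=
  [seq B <- [seq P :&: Q | P <- p, Q <- s] | B != set0].

Definition restr s P : seq {set T} :=
  [seq B <- [seq P :&: Q | Q <- s] | B != set0].

Definition one_block A : seq {set T} := [:: A].

Lemma is_osp_one_block A : A != set0 -> is_osp A (one_block A).
Proof. by move=> A0; rewrite /is_osp inE eq_sym A0 /= big_seq1 eqxx. Qed.

Lemma is_osp_restr A s P :
  is_osp A s -> P \subset A -> is_osp P (restr s P).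
Proof.
move=> /and3P[_ dis /eqP sA] PA; apply/and3P; split.
- by rewrite mem_filter eqxx.
- apply: pairwise_filter; rewrite pairwise_map; apply: sub_pairwise dis => B C.
  move=> /= BC; rewrite -setI_eq0 setIACA setIid.
  by move: BC; rewrite -setI_eq0 => /eqP->; rewrite setI0.
- apply/eqP; rewrite big_filter big_map -[RHS](setIidPl PA) -sA big_distrr /=.
  by rewrite big_mkcond; apply: eq_bigr => B _; case: eqP.
Qed.

End OrderedSetPartitions.

Section Coefficients.
Variables (R : fieldType) (T : finType).
Implicit Types (A : {set T}) (sigma pi tau eta : seq {set T}).

(* [zeta] and [mu] are only used for sigma <= pi; then |pi| <= |sigma| and the
   subtraction of natural numbers in the exponent is exact. *)
Definition zeta sigma pi : R :=
  (\prod_(P <- pi) ((size (restr sigma P))`!)%:R)^-1.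

Definition mu sigma pi : R :=
  (-1) ^+ (size sigma - size pi) / \prod_(P <- pi) (size (restr sigma P))%:R.

Definition weisner A tau eta : R :=
  \sum_(sigma : OP A | qmeet sigma eta == tau) mu sigma (one_block A).

Definition goldberg A tau eta : R :=
  \sum_(sigma : OP A | op_le tau sigma) zeta tau sigma * weisner A sigma eta.

Definition pweisner A tau eta pi : R :=
  \sum_(sigma : OP A | (qmeet sigma eta == tau) && op_le sigma pi) mu sigma pi.

Definition pgoldberg A tau eta pi : R :=
  \sum_(sigma : OP A | op_le tau sigma)
     zeta tau sigma * pweisner A sigma eta pi.

End Coefficients.

Definition des (m : seq nat) : nat :=
  #|[set i : 'I_(size m).-1 | (nth 0%N m i > nth 0%N m i.+1)%N]|.

Definition asc (m : seq nat) : nat :=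
  #|[set i : 'I_(size m).-1 | (nth 0%N m i < nth 0%N m i.+1)%N]|.

Fixpoint level_runs (m : seq nat) : seq (seq nat) :=
  if m is x :: m' then
    if level_runs m' is (y :: r) :: rs then
      if x == y then (x :: y :: r) :: rs else [:: x] :: (y :: r) :: rs
    else [:: [:: x]]
  else [::].

(* Decomposition of m into nonempty constant runs that are maximal: two
   consecutive runs have different values. *)
Lemma level_runsP m :
  [/\ flatten (level_runs m) = m,
      all (fun r => (r != [::]) && constant r) (level_runs m)
    & sorted (fun r r' => head 0%N r != head 0%N r') (level_runs m)].
Proof.
elim: m => [|x m [IH1 IH2 IH3]] //=.
case E: (level_runs m) IH1 IH2 IH3 => [|[|y r] rs] //=.
  by move=> <-.
move=> IH1 /andP[IHr IH2] IH3; case: eqP => [->|/eqP xy] /=.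
  by rewrite IH1 eqxx IH2 IHr; split => //; case: (rs) IH3.
by rewrite IH1 IHr IH2 xy IH3; split.
Qed.

Definition run_lengths (m : seq nat) : seq nat := map size (level_runs m).

(* The sequence (m_i), with the blocks of eta numbered from 0; it is only
   meaningful when tau refines eta. *)
Definition block_index (T : finType) (tau eta : seq {set T}) : seq nat :=
  [seq find (fun E : {set T} => P \subset E) eta | P : {set T} <- tau].

Definition des_eta (T : finType) (eta tau : seq {set T}) : nat :=
  des (block_index tau eta).

Definition asc_eta (T : finType) (eta tau : seq {set T}) : nat :=
  asc (block_index tau eta).

Definition stirling2 (q k : nat) : nat :=
  #|[set P : {set {set 'I_q}} | partition P [set: 'I_q] & #|P| == k]|.

Definition one_line (n : nat) (s : 'S_n) : seq nat :=
  [seq val (s i) | i <- enum 'I_n].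

Definition eulerian (R : comNzRingType) (n : nat) (x y : R) : R :=
  \sum_(s : 'S_n) x ^+ des (one_line s) * y ^+ asc (one_line s).

Definition Ppoly (R : comNzRingType) (q : nat) (x : R) : R :=
  \sum_(1 <= k < q.+1) (k`! * stirling2 q k)%:R * x ^+ k.-1.

Notation OPn n := (OP [set: 'I_n]).
Notation goldbergn R n := (goldberg R [set: 'I_n]).
Notation pgoldbergn R n := (pgoldberg R [set: 'I_n]).

(* Main.v *)
Require Import Defs.
From mathcomp Require Import all_boot all_order all_algebra all_fingroup.
From mathcomp Require Import all_classical all_reals all_analysis.
From mathcomp Require Import fintype finset.

Set Implicit Arguments.
Unset Strict Implicit.
Unset Printing Implicit Defensive.

Import GRing.Theory Num.Theory numFieldNormedType.Exports.
Local Open Scope ring_scope.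

(** Under the quasi-meet, ordered set partitions form a band, and
    [tau <= sigma] says exactly that [sigma] fixes [tau], i.e. the quasi-meet of
    [sigma] with [tau] is [tau] ([op_leE]). So the elements above [tau] are the
    ways of merging consecutive blocks of [tau] ([sum_coarser]), and those
    [rho] whose quasi-meet with [eta] is [sigma] are the mergings of [sigma]
    in which every merged run visits later and later blocks of [eta]
    ([sum_qmeet_fiber]). Both sums defining the Goldberg coefficient thus run
    over groupings of a sequence of numbers, the positions [m] in [eta] of the
    blocks of [tau] ([goldbergE]): an outer grouping with constant groups,
    weighted by inverse factorials, and then an inner grouping with increasing
    groups, weighted by [(-1)^(k-1)/k] when it has [k] groups.

    The weight [(-1)^(k-1)/k] is the integral of [x^(k-1)] over [[-1, 0]]. Under
    the integral each cut between two groups contributes a factor [x], whatever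
    the other cuts are. The inner sum is then a product over adjacent entries:
    a cut is forced at a non-ascent, giving [x], and is optional at an ascent,
    giving [1 + x] ([increasing_sum_cons2]). The outer groups stay inside level
    runs, so the total factors ([level_sum_runs]): the borders between
    level runs give [x^des (1+x)^asc], and a level run of length [q] gives the
    sum over compositions of [q] of [x^(k-1)] over the factorials of the parts.
    This is [P_q(x)/q!], since a multinomial coefficient counts the ordered set
    partitions of a [q]-set with given block sizes ([sum_ops_groupings]), while
    those with [k] blocks are the orderings of the set partitions with [k]
    blocks ([sum_ops_partitions]).

    For the Eulerian polynomials, let [eta] list the singletons of a [q]-set in
    increasing order. The quasi-meet of any [rho] with [eta] lists the
    singletons in the order of some permutation [w], and by [sum_qmeet_fiber]
    the [rho] leading to [w] contribute [x^des(w) (1+x)^asc(w)]. Summing over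
    [w] gives the sum over all ordered set partitions once more ([eulerianE]).

    For the partitioned coefficients, the middle summation index is determined
    by the innermost one, so the coefficient is a single sum over the
    [rho <= pi] ([pgoldberg_single_sum]). Such a [rho] is the concatenation of
    its restrictions to the blocks of [pi], chosen independently
    ([sum_ops_below]), and the summation condition, [zeta] and [mu] all factor
    through the restrictions. *)

(** * The band of ordered set partitions *)

Section QuasiMeet.
Variable T : finType.
Implicit Types (A B P Q S : {set T}) (p r s t u : seq {set T}).

Lemma restr0 s : restr s set0 = [::].
Proof. by elim: s => //= P s IH; rewrite /restr /= set0I eqxx. Qed.

Lemma restr_cons P s Q :
  restr (P :: s) Q =
  if Q :&: P != set0 then Q :&: P :: restr s Q else restr s Q.
Proof. by []. Qed.

Lemma restr_cat s t P : restr (s ++ t) P = restr s P ++ restr t P.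
Proof. by rewrite /restr map_cat filter_cat. Qed.

Lemma qmeet_cons P p s : qmeet (P :: p) s = restr s P ++ qmeet p s.
Proof. by rewrite /qmeet /= filter_cat. Qed.

Lemma qmeetE p s : qmeet p s = flatten [seq restr s P | P <- p].
Proof. by elim: p => //= P p IH; rewrite qmeet_cons IH. Qed.

Lemma qmeet_cat p r s : qmeet (p ++ r) s = qmeet p s ++ qmeet r s.
Proof. by rewrite !qmeetE map_cat flatten_cat. Qed.

Lemma restr_restr s P Q : restr (restr s P) Q = restr s (P :&: Q).
Proof.
elim: s => //= S s IH; rewrite !restr_cons.
case: (eqVneq (P :&: S) set0) => [PS|PS] /=; rewrite ?restr_cons IH.
  by rewrite setIAC PS set0I eqxx.
by rewrite setIA [Q :&: P]setIC.
Qed.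

(** Meeting with [P] first and distributing later is associativity with the
    one-block sequence [P] on the left; hence [qmeetA]. *)
Lemma restr_qmeet s u P : restr (qmeet s u) P = qmeet (restr s P) u.
Proof.
elim: s => //= S s IH; rewrite qmeet_cons restr_cat restr_restr IH restr_cons.
case: (eqVneq (P :&: S) set0) => [PS|PS] /=; last by rewrite qmeet_cons setIC.
by rewrite setIC PS restr0.
Qed.

Lemma qmeetA p s u : qmeet p (qmeet s u) = qmeet (qmeet p s) u.
Proof.
by elim: p => //= P p IH; rewrite !qmeet_cons qmeet_cat IH restr_qmeet.
Qed.

Lemma restrP s P B :
  reflect (exists2 S, S \in s & B = P :&: S /\ B != set0) (B \in restr s P).
Proof.
rewrite mem_filter; apply: (iffP andP) => [[B0 /mapP[S Ss eB]]|[S Ss [-> PS]]].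
  by exists S.
by split=> //; apply: map_f.
Qed.

Lemma restr_id s P :
  set0 \notin s -> {in s, forall S, S \subset P} -> restr s P = s.
Proof.
elim: s => //= S s IH; rewrite inE negb_or eq_sym => /andP[S0 s0] sub.
rewrite restr_cons (setIidPr (sub S _)) ?mem_head // S0 IH // => Q Qs.
by apply: sub; rewrite inE Qs orbT.
Qed.

Lemma restr_disjoint s P :
  {in s, forall S, [disjoint S & P]} -> restr s P = [::].
Proof.
elim: s => //= S s IH dis.
rewrite restr_cons setIC disjoint_setI0 ?dis ?mem_head // eqxx IH // => Q Qs.
by apply: dis; rewrite inE Qs orbT.
Qed.

Lemma osp_cons A P s :
  is_osp A (P :: s) = [&& P != set0, P \subset A & is_osp (A :\: P) s].
Proof.
rewrite /is_osp inE negb_or eq_sym /= big_cons.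
set U := \bigcup_(Q <- s) Q.
have -> : all (fun Q => [disjoint P & Q]) s = (P :&: U == set0).
  rewrite /U; elim: (s) => [|S r IH] /=; first by rewrite big_nil setI0 eqxx.
  by rewrite big_cons IH setIUr setU_eq0 -setI_eq0.
case: (P != set0) => //=; case: (set0 \notin s); rewrite /= ?andbF //.
case: (pairwise _ s); rewrite /= ?andbT ?andbF //.
apply/andP/andP => [[/eqP PU /eqP <-]|[PA /eqP UA]].
  rewrite subsetUl setDUl setDv set0U; split=> //; apply/eqP/esym/setDidPl.
  by rewrite -setI_eq0 setIC PU.
rewrite UA setDE setICA setICr setI0 eqxx; split=> //.
by rewrite setUIr setUCr setIT (setUidPr PA).
Qed.

Lemma osp_nil A : is_osp A [::] = (A == set0).
Proof. by rewrite /is_osp big_nil /= eq_sym. Qed.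

(** Decomposing a sequence at an arbitrary place is what makes inductions on
    ordered set partitions possible: the tail is an ordered set partition of
    what the head leaves over. *)
Lemma osp_cat A s t :
  is_osp A (s ++ t) =
  [&& \bigcup_(P <- s) P \subset A, is_osp (\bigcup_(P <- s) P) s
    & is_osp (A :\: \bigcup_(P <- s) P) t].
Proof.
elim: s A => [|P s IH] A /=.
  by rewrite big_nil sub0set osp_nil eqxx setD0.
rewrite !osp_cons {}IH big_cons /=; set U := \bigcup_(Q <- s) Q.
case: (P != set0); rewrite /= ?andbF //.
rewrite subsetUl subUset setDDl setDUl setDv set0U subsetD.
case: (P \subset A) => //=; case: (U \subset A) => //=.
case dUP: [disjoint U & P] => /=; first by rewrite (setDidPl dUP).
apply/esym/andP => -[/and3P[_ _ /eqP]]; rewrite -/U => eU _.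
by move: dUP; rewrite eU -setI_eq0 setIDAC -setIDA setDv setI0 eqxx.
Qed.

Lemma osp_notin0 A s : is_osp A s -> set0 \notin s.
Proof. by case/and3P. Qed.

Lemma osp_bigcup A s : is_osp A s -> \bigcup_(P <- s) P = A.
Proof. by case/and3P => _ _ /eqP. Qed.

Lemma osp_sub A s P : is_osp A s -> P \in s -> P \subset A.
Proof. by move=> /osp_bigcup <- Ps; rewrite bigcup_seq (bigcup_sup P). Qed.

Lemma osp_restr_id A s : is_osp A s -> restr s A = s.
Proof.
by move=> sA; apply: restr_id => [|S]; [apply: osp_notin0 sA|apply: osp_sub].
Qed.

Lemma restr_union A s b t :
  is_osp A (s ++ b ++ t) -> restr (s ++ b ++ t) (\bigcup_(P <- b) P) = b.
Proof.
rewrite !osp_cat; set U := \bigcup_(P <- s) P; set V := \bigcup_(P <- b) P.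
case/and3P => UA sU /and3P[VAU bV tAUV].
rewrite !restr_cat (osp_restr_id bV) !restr_disjoint ?cats0 // => S /osp_sub.
  move=> /(_ _ tAUV); rewrite subsetD => /andP[_]; exact.
move=> /(_ _ sU) SU; rewrite disjoint_sym; apply: disjointWr SU _.
by move: VAU; rewrite subsetD => /andP[].
Qed.

Lemma osp_flatten A p (f : {set T} -> seq {set T}) :
  is_osp A p -> {in p, forall P, is_osp P (f P)} ->
  is_osp A (flatten [seq f P | P <- p]).
Proof.
elim: p A => [|P p IH] A //=; rewrite osp_cons => /and3P[P0 PA pA] fP.
have Pf : is_osp P (f P) by apply: fP; rewrite mem_head.
rewrite osp_cat (osp_bigcup Pf) PA Pf IH // => Q Qp.
by apply: fP; rewrite inE Qp orbT.
Qed.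

Lemma osp_qmeet A B p s :
  is_osp A p -> is_osp B s -> A \subset B -> is_osp A (qmeet p s).
Proof.
move=> pA sB AB; rewrite qmeetE; apply: osp_flatten => // P Pp.
by apply: is_osp_restr sB _; apply: subset_trans (osp_sub pA Pp) AB.
Qed.

Lemma in_restr_sub s P B : B \in restr s P -> B \subset P.
Proof. by case/restrP => S _ [-> _]; apply: subsetIl. Qed.

Lemma osp_disjoint A s : is_osp A s ->
  {in s &, forall P Q, P != Q -> [disjoint P & Q]}.
Proof.
elim: s A => // S s IH A; rewrite osp_cons => /and3P[S0 SA sAS] P Q.
rewrite !inE => /orP[/eqP->|Ps] /orP[/eqP->|Qs]; first by rewrite eqxx.
- by move=> _; move: (osp_sub sAS Qs); rewrite subsetD disjoint_sym => /andP[].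
- by move=> _; move: (osp_sub sAS Ps); rewrite subsetD => /andP[].
- exact: IH sAS _ _ Ps Qs.
Qed.

Lemma osp_uniq A s : is_osp A s -> uniq s.
Proof.
elim: s A => // S s IH A; rewrite osp_cons => /and3P[S0 SA sAS] /=.
rewrite (IH _ sAS) andbT; apply: contraNN S0 => Ss.
by move: (osp_sub sAS Ss); rewrite subsetD -setI_eq0 setIid => /andP[].
Qed.

Lemma osp_neq0 A s P : is_osp A s -> P \in s -> P != set0.
Proof. by move=> /osp_notin0 s0 Ps; apply: contraNneq s0 => <-. Qed.

Lemma restr_block A s P : is_osp A s -> P \in s -> restr s P = [:: P].
Proof.
move=> sA Ps; have := sA; case/splitPr: Ps sA => s1 s2 sA.
by move: (sA); rewrite -cat1s => /restr_union; rewrite big_seq1.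
Qed.

Lemma qmeet_id A s : is_osp A s -> qmeet s s = s.
Proof.
move=> sA; rewrite qmeetE -[RHS](@flatten_seq1 _ s); congr flatten.
by apply/eq_in_map => P Ps; apply: restr_block sA Ps.
Qed.

End QuasiMeet.

(** * The order in terms of the quasi-meet *)

(** To be used with [k] the position, in a coarser partition, of the blocks of
    [s]: regrouping the blocks by increasing position leaves them in place as
    soon as the positions are weakly increasing. *)
Lemma flatten_level_sets (X : eqType) (k : X -> nat) (s : seq X) (n : nat) :
  sorted leq (map k s) ->
  flatten [seq [seq x <- s | k x == j] | j <- iota 0 n]
    = [seq x <- s | (k x < n)%N].
Proof.
move=> srt; elim: n => [|n IH]; first by rewrite filter_pred0.
rewrite -addn1 iotaD map_cat flatten_cat {}IH /= cats0 add0n addn1.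
elim: s srt => //= x s IH; rewrite path_sortedE; last exact: leq_trans.
case/andP=> /allP le_x /IH{}IH; rewrite ltnS.
have none j : (j <= k x)%N -> [seq y <- s | (k y < j)%N] = [::].
  move=> jx; apply/eqP; rewrite -[_ == _]negbK -has_filter -all_predC.
  by apply/allP => y ys /=; rewrite -leqNgt (leq_trans jx) // le_x // map_f.
case: ltngtP => xn //=; first by rewrite IH.
by rewrite -IH none // xn.
Qed.

Section Order.
Variable T : finType.
Implicit Types (A B P Q S : {set T}) (p r s t u : seq {set T}).

Definition position s P := find (fun S => P \subset S) s.

Lemma refinesE p s : refines (underlying p) (underlying s) =
  all (fun P => has (fun S => P \subset S) s) p.
Proof.
apply/forall_inP/allP => sub P; last first.
  rewrite inE => /sub/hasP[S Ss PS]; apply/exists_inP; exists S => //.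
  by rewrite inE.
move=> Pp; have /sub/exists_inP[S] : P \in underlying p by rewrite inE.
by rewrite inE => Ss PS; apply/hasP; exists S.
Qed.

(** Blocks being disjoint, a nonempty set lies in at most one of them, so that
    [find] detects the block and not merely the first candidate. *)
Lemma position_nth A s P i : is_osp A s -> P != set0 -> (i < size s)%N ->
  (P \subset nth set0 s i) = (position s P == i).
Proof.
move=> sA P0 ltis; apply/idP/eqP => [Pi|posP]; last first.
  rewrite -posP; apply: (nth_find set0 (a := fun S => P \subset S)).
  by rewrite has_find [X in (X < _)%N]posP.
have hasP : has (fun S => P \subset S) s.
  by apply/hasP; exists (nth set0 s i); rewrite ?mem_nth.
apply/eqP; rewrite -(nth_uniq set0 _ ltis (osp_uniq sA)) -?has_find //.
apply: contraNT P0 => neq; rewrite -subset0.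
have lt : (position s P < size s)%N by rewrite -has_find.
have := osp_disjoint sA (mem_nth set0 lt) (mem_nth set0 ltis) neq.
rewrite -setI_eq0 => /eqP <-; rewrite subsetI Pi andbT.
exact: (nth_find set0 hasP).
Qed.

Lemma osp_meet A s P B : is_osp A s -> B != set0 -> P \in s ->
  {in s, forall S, B \subset S -> B :&: P != set0 -> S = P}.
Proof.
move=> sA B0 Ps S Ss BS; apply: contraNeq => SP; rewrite -subset0.
have /eqP <- : S :&: P == set0 by rewrite setI_eq0 (osp_disjoint sA).
exact: setSI.
Qed.

(** A block of [s] lies in one block of [t] and is disjoint from the others, so
    the blocks of [t] cut no block of [s]. *)
Lemma restr_refine A s t i : is_osp A t -> set0 \notin s ->
  refines (underlying s) (underlying t) -> (i < size t)%N ->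
  restr s (nth set0 t i) = [seq P <- s | position t P == i].
Proof.
move=> tA s0; rewrite refinesE => st ltit.
elim: s s0 st => //= P s IH; rewrite inE negb_or eq_sym => /andP[P0 s0].
case/andP => /hasP[S St PS] /(IH s0){}IH.
rewrite restr_cons IH setIC -(position_nth tA) //.
case: (boolP (P \subset _)) => [/setIidPl-> //|]; first by rewrite P0.
case: eqP => //= /eqP PQ;
  rewrite -(osp_meet tA P0 (mem_nth set0 ltit) St PS PQ).
by rewrite PS.
Qed.

Lemma osp_refines_position A s t P : is_osp A t ->
  refines (underlying s) (underlying t) -> P \in s ->
  (position t P < size t)%N.
Proof.
by move=> tA; rewrite refinesE => /allP st /st; rewrite has_find.
Qed.

Lemma qmeet_level_sets A s t : is_osp A t -> set0 \notin s ->
  refines (underlying s) (underlying t) ->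
  qmeet t s =
    flatten [seq [seq P <- s | position t P == j] | j <- iota 0 (size t)].
Proof.
move=> tA s0 st; rewrite qmeetE; congr flatten.
rewrite -{1}(mkseq_nth set0 t) -map_comp; apply/eq_in_map => j.
by rewrite mem_iota /= => ltj; apply: restr_refine tA s0 st ltj.
Qed.

Lemma qmeet_refines p s t : qmeet p s = t ->
  refines (underlying t) (underlying p) &&
  refines (underlying t) (underlying s).
Proof.
move=> <-; rewrite !refinesE; apply/andP; split; apply/allP => B;
  rewrite qmeetE => /flatten_mapP[P Pp /restrP[S Ss [-> _]]]; apply/hasP.
  by exists P => //; apply: subsetIl.
by exists S => //; apply: subsetIr.
Qed.

(** The quasi-meet with [s] regroups the blocks of [t] along those of [s] when
    [t] refines [s]; monotonicity of the blocks says that the regrouping moves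
    none of them. *)
Lemma op_leE A t s : is_osp A t -> is_osp A s ->
  op_le t s = (qmeet s t == t).
Proof.
move=> tA sA; have t0 := osp_notin0 tA; apply/andP/eqP => [[ts le]|st].
  rewrite (qmeet_level_sets sA t0 ts) flatten_level_sets.
    by apply/all_filterP/allP => P; apply: osp_refines_position sA ts.
  rewrite sorted_map; apply/(sortedP set0) => i lti.
  have lt j : (j < size t)%N -> (position s (nth set0 t j) < size s)%N.
    by move=> ltj; apply: osp_refines_position sA ts _; apply: mem_nth.
  have sub j (ltj : (j < size t)%N) :
      nth set0 t j \subset nth set0 s (Ordinal (lt j ltj)).
    by rewrite (position_nth sA) ?(osp_neq0 tA) ?mem_nth.
  have ltj := ltnW lti.
  move/forallP: le => /(_ (Ordinal ltj))/forallP/(_ (Ordinal lti)).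
  move=> /forallP/(_ (Ordinal (lt _ ltj)))/forallP/(_ (Ordinal (lt _ lti))).
  by rewrite /= -/(is_true _) ltnSn !sub.
have /andP[-> _] := qmeet_refines st; split=> //.
(* If [k > l], split [s] just before its block [k]: the block [i] of [t] comes
   from the second half and the block [j] from the first, against [i < j]. *)
have pos a P : (a < size s)%N -> P \in t -> P \subset nth set0 s a ->
    position s P = a.
  by move=> lta Pt; rewrite (position_nth sA) ?(osp_neq0 tA) // => /eqP.
apply/forallP => i; apply/forallP => j; apply/forallP => k; apply/forallP => l.
apply/implyP => /and3P[ltij ik jl]; rewrite leqNgt; apply/negP => ltlk.
have tE : t = qmeet (take k s) t ++ qmeet (drop k s) t.
  by rewrite -qmeet_cat cat_take_drop.
have nthE a : nth set0 t a =
    nth set0 (qmeet (take k s) t ++ qmeet (drop k s) t) a by rewrite -tE.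
have posi := pos _ _ (ltn_ord k) (mem_nth set0 (ltn_ord i)) ik.
have posj := pos _ _ (ltn_ord l) (mem_nth set0 (ltn_ord j)) jl.
have inE_qmeet q P : P \in qmeet q t -> exists2 Q, Q \in q & P \subset Q.
  by rewrite qmeetE => /flatten_mapP[Q Qq /in_restr_sub]; exists Q.
have ltks := ltn_ord k.
have lo P : P \in t -> P \in qmeet (take k s) t -> (position s P < k)%N.
  move=> Pt /inE_qmeet[_ /(nthP set0)[a + <-]];
    rewrite (size_takel (ltnW ltks)) => ltak.
  by rewrite nth_take // => /pos->//; apply: ltn_trans ltks.
have hi P : P \in t -> P \in qmeet (drop k s) t -> (k <= position s P)%N.
  move=> Pt /inE_qmeet[_ /(nthP set0)[a + <-]];
    rewrite size_drop ltn_subRL => lta.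
  by rewrite nth_drop => /pos->//; apply: leq_addr.
have [ltiu|leui] := ltnP i (size (qmeet (take k s) t)).
  have: nth set0 t i \in qmeet (take k s) t.
    by rewrite nthE nth_cat ltiu mem_nth.
  by move/lo; rewrite posi ltnn mem_nth // => /(_ isT).
have ltuj : (size (qmeet (take k s) t) <= j)%N.
  exact: leq_trans leui (ltnW ltij).
have: nth set0 t j \in qmeet (drop k s) t.
  rewrite nthE nth_cat ltnNge ltuj /= mem_nth // ltn_subLR // -size_cat -tE.
  exact: ltn_ord.
by move/hi; rewrite posj leqNgt ltlk mem_nth // => /(_ isT).
Qed.

End Order.

(** * Groupings of a sequence into consecutive pieces *)

Section Groupings.
Variable X : eqType.
Implicit Types (s t b : seq X) (g h : seq (seq X)).

Fixpoint groupings (s : seq X) : seq (seq (seq X)) :=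
  if s is x :: s' then
    [seq [:: x] :: g | g <- groupings s'] ++
    (if s' is _ :: _ then
       [seq (x :: head [::] g) :: behead g | g <- groupings s']
     else [::])
  else [:: [::]].

Lemma groupings_cons2 x y s : groupings [:: x, y & s] =
  [seq [:: x] :: g | g <- groupings (y :: s)] ++
  [seq (x :: head [::] g) :: behead g | g <- groupings (y :: s)].
Proof. by []. Qed.

Lemma mem_groupings s g :
  (g \in groupings s) = (flatten g == s) && ([::] \notin g).
Proof.
elim: s g => [|x s IH] g.
  by rewrite inE; case: g => [|[|y b] g] //=; rewrite andbF.
rewrite /= mem_cat.
apply/orP/andP => [|[/eqP]].
  case=> [/mapP[h]|].
    by rewrite IH => /andP[/eqP <- h0] -> /=; rewrite eqxx.
  case: s IH => // y s IH /mapP[[|[|z b] h]];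
    rewrite IH /= ?inE ?andbF //= => /andP[/eqP <- h0] ->.
  by rewrite eqxx.
case: g => [|[|y [|z b]] g] //= [-> gs].
  by move=> g0; left; apply: map_f; rewrite IH gs eqxx.
move=> g0; right; rewrite -gs; apply/mapP; exists ((z :: b) :: g) => //.
by rewrite gs IH /= gs eqxx.
Qed.

Lemma groupings_uniq s : uniq (groupings s).
Proof.
elim: s => // x [|y s] IH //; rewrite groupings_cons2.
rewrite cat_uniq; apply/and3P; split.
- by rewrite map_inj_uniq // => g h [].
- apply/hasPn => B /mapP[[|[|z b] g]]; rewrite mem_groupings ?inE ?andbF //.
  by move=> _ ->; apply/mapP => -[h _ []].
- rewrite map_inj_in_uniq // => -[|b g] [|c h]; rewrite !mem_groupings //.
  by move=> _ _ /= [-> ->].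
Qed.

End Groupings.

Lemma groupings_map (X Y : eqType) (f : X -> Y) (s : seq X) :
  groupings (map f s) = map (map (map f)) (groupings s).
Proof.
elim: s => //= x s ->; rewrite map_cat -!map_comp; congr cat.
by case: s => //= y s; rewrite -!map_comp; apply: eq_map => -[|b g].
Qed.

Section Sums.
Variables (V : nmodType) (X : eqType).
Implicit Types (s : seq X) (g h : seq (seq X)).

(** The first entry is either a group of its own or joins the first group of the
    rest. The default value of [head] is never reached, since a nonempty
    sequence has no empty grouping. *)
Lemma sum_groupings_cons2 x y s (F : seq (seq X) -> V) :
  \sum_(g <- groupings [:: x, y & s]) F g =
  \sum_(g <- groupings (y :: s))
     (F ([:: x] :: g) + F ((x :: head [::] g) :: behead g)).
Proof. by rewrite groupings_cons2 big_cat !big_map big_split. Qed.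

Lemma sum_groupings_first x s (F : seq (seq X) -> V) :
  \sum_(g <- groupings (x :: s)) F g =
  \sum_(i < (size s).+1)
     \sum_(g <- groupings (drop i s)) F ((x :: take i s) :: g).
Proof.
elim: s x F => [|y s IH] x F.
  by rewrite big_ord_recl big_ord0 addr0 /= !big_seq1.
rewrite sum_groupings_cons2 big_split /=.
rewrite (IH y (fun g => F ((x :: head [::] g) :: behead g))).
by rewrite [RHS]big_ord_recl.
Qed.

End Sums.

(** * Coarsenings of an ordered set partition *)

Section Transfer.
Variable T : finType.
Implicit Types (A B P Q S : {set T}) (p r s t u : seq {set T}).
Implicit Types (g h : seq (seq {set T})).

(** The ordered set partitions of [A] as bare sequences, so that sums over
    different ground sets can be compared term by term. *)
Definition ops A : seq (seq {set T}) := [seq val (val rho) | rho : OP A].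

Lemma mem_ops A s : (s \in ops A) = is_osp A s.
Proof.
apply/mapP/idP => [[rho _ ->]|sA]; first exact: op_blocksP.
by have [rho rhoE] := exists_OP sA; exists rho; rewrite ?mem_enum.
Qed.

Lemma ops_uniq A : uniq (ops A).
Proof.
rewrite map_inj_uniq ?enum_uniq // => rho1 rho2 eq12.
by apply/val_inj/val_inj.
Qed.

Lemma sum_ops (V : nmodType) A (Q : pred (seq {set T})) (F : seq {set T} -> V) :
  \sum_(rho : OP A | Q rho) F rho = \sum_(s <- ops A | Q s) F s.
Proof. by rewrite big_map big_enum_cond. Qed.

Definition unions g : seq {set T} := [seq \bigcup_(P <- b) P | b <- g].

(** The other pieces are disjoint from this union and leave no trace in it. *)
Lemma restr_piece A s g b : is_osp A s -> g \in groupings s -> b \in g ->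
  restr s (\bigcup_(P <- b) P) = b.
Proof.
rewrite mem_groupings => sA /andP[/eqP sE _] bg.
rewrite -sE; case/splitPr: bg sE => g1 g2.
by rewrite flatten_cat /= => sE; apply: (@restr_union _ A); rewrite sE.
Qed.

Lemma restr_unions A s g : is_osp A s -> g \in groupings s ->
  [seq restr s U | U <- unions g] = g.
Proof.
move=> sA gs; rewrite -map_comp -[RHS]map_id.
by apply/eq_in_map => b /(restr_piece sA gs).
Qed.

Lemma osp_unions A s g : is_osp A s -> g \in groupings s -> is_osp A (unions g).
Proof.
rewrite mem_groupings => + /andP[/eqP sE].
elim: g A s sE => [|b g IH] A s /= <-; first by [].
rewrite osp_cat osp_cons inE negb_or => /and3P[bA bU gA] /andP[b0 g0].
rewrite bA (IH _ (flatten g)) // andbT; case: b {bA gA} b0 bU => // P b _.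
rewrite osp_cons big_cons andbT => /and3P[/set0Pn[x xP] _ _].
by apply/set0Pn; exists x; rewrite inE xP.
Qed.

(** The elements above [s] are the mergings of consecutive blocks of [s]: the
    grouping is recovered from [rho] by restricting [s] to the blocks of [rho],
    and its pieces concatenate to [s] by [op_leE]. *)
Lemma sum_coarser (V : nmodType) A s (Q : pred (seq {set T}))
    (F : seq {set T} -> V) : is_osp A s ->
  \sum_(rho : OP A | op_le s rho && Q rho) F rho =
  \sum_(g <- groupings s | Q (unions g)) F (unions g).
Proof.
move=> sA; rewrite (sum_ops _ (fun rho => op_le s rho && Q rho) F).
rewrite -big_filter_cond -(big_map unions Q F); apply: perm_big.
apply: uniq_perm; first by rewrite filter_uniq ?ops_uniq.
  rewrite map_inj_in_uniq ?groupings_uniq // =>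
    g h gs hs /(congr1 (map (restr s))).
  by rewrite !(restr_unions sA).
move=> rho; rewrite mem_filter mem_ops;
  apply/andP/mapP => [[le rhoA]|[g gs ->]].
  move: le; rewrite (op_leE sA rhoA) => /eqP le.
  exists [seq restr s U | U <- rho].
    rewrite mem_groupings -qmeetE le eqxx; apply/mapP => -[U Urho /esym].
    move=> sU; have := osp_bigcup (is_osp_restr sA (osp_sub rhoA Urho)).
    by rewrite sU big_nil => U0; have := osp_neq0 rhoA Urho; rewrite -U0 eqxx.
  rewrite /unions -map_comp -[LHS]map_id; apply/eq_in_map => U Urho /=.
  by rewrite (osp_bigcup (is_osp_restr sA (osp_sub rhoA Urho))).
have gA := osp_unions sA gs; split=> //.
rewrite (op_leE sA gA) qmeetE (restr_unions sA gs).
by move: gs; rewrite mem_groupings => /andP[].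
Qed.

End Transfer.

(** * Weisner and Goldberg coefficients as sums over groupings *)

Section Weisner.
Variable T : finType.
Implicit Types (A B P Q S U : {set T}) (p r s t u b e : seq {set T}).
Implicit Types (g h : seq (seq {set T})).

Lemma position_restr A e U : is_osp A e ->
  map (position e) (restr e U) =
  [seq j <- iota 0 (size e) | U :&: nth set0 e j != set0].
Proof.
move=> eA; rewrite /restr -{2}(mkseq_nth set0 e) -map_comp filter_map -map_comp.
rewrite -[RHS]map_id; apply/eq_in_map => j.
rewrite mem_filter mem_iota /= => /andP[U0 ltj].
by apply/eqP; rewrite -(position_nth eA U0 ltj) subsetIr.
Qed.

Lemma position_mem A e Q i x : is_osp A e -> (position e Q < size e)%N ->
  (i < size e)%N -> x \in Q -> x \in nth set0 e i -> position e Q = i.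
Proof.
move=> eA ltQ lti xQ; apply: contraTeq => neq.
have xE : x \in nth set0 e (position e Q).
  by apply: subsetP xQ; apply: (nth_find set0 (a := fun E => Q \subset E));
    rewrite has_find.
have := osp_disjoint eA (mem_nth set0 ltQ) (mem_nth set0 lti).
rewrite nth_uniq ?(osp_uniq eA) // => /(_ neq).
by rewrite disjoint_subset => /subsetP/(_ x xE); rewrite inE.
Qed.

(** Restricting [e] to the union [U] of [b] lists [U] along the blocks of [e].
    This gives back [b] when no two blocks of [b] share a block of [e] and they
    already come in the order of [e]. *)
Lemma restr_eq_sorted A e U b : is_osp A e -> is_osp U b ->
  refines (underlying b) (underlying e) ->
  (restr e U == b) = sorted ltn (map (position e) b).
Proof.
move=> eA bU be; apply/eqP/idP => [<-|srt].
  by rewrite (position_restr _ eA) sorted_filter ?iota_ltn_sorted //;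
    apply: ltn_trans.
have srt' : sorted ltn (map (position e) (restr e U)).
  by rewrite (position_restr _ eA) sorted_filter ?iota_ltn_sorted //;
    apply: ltn_trans.
move: srt srt'; rewrite !sorted_map => srt srt'.
have ltT : transitive (relpre (position e) ltn).
  by move=> x y z; apply: ltn_trans.
have ltI : irreflexive (relpre (position e) ltn) by move=> x; apply: ltnn.
have posI : {in b &, injective (position e)}.
  move: srt; rewrite -sorted_map => /sorted_uniq uq.
  have {}uq : uniq (map (position e) b) by apply: uq ltnn; apply: ltn_trans.
  move=> P Q /(nthP set0)[i lti <-] /(nthP set0)[j ltj <-].
  rewrite -!(nth_map set0 0%N) // => /eqP.
  by rewrite nth_uniq ?size_map // => /eqP->.
have cut P : P \in b -> U :&: nth set0 e (position e P) = P.
  move=> Pb; have ltP := osp_refines_position eA be Pb.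
  have PE : P \subset nth set0 e (position e P).
    by rewrite (position_nth eA) // (osp_neq0 bU).
  apply/eqP; rewrite eqEsubset subsetI (osp_sub bU Pb) PE !andbT.
  apply/subsetP => x; rewrite inE -{1}(osp_bigcup bU) bigcup_seq => /andP[].
  case/bigcupP => Q Qb xQ xE; rewrite -(posI Q P) //.
  exact: position_mem eA (osp_refines_position eA be Qb) ltP xQ xE.
apply: (irr_sorted_eq ltT ltI) => // P; apply/idP/idP => [|Pb].
  case/restrP => E /(nthP set0)[j ltj <-] [-> /set0Pn[x]].
  rewrite inE -{1}(osp_bigcup bU) bigcup_seq => /andP[/bigcupP[Q Qb xQ]] xE.
  by rewrite -(position_mem eA (osp_refines_position eA be Qb) ltj xQ xE) cut.
rewrite -(cut P Pb); apply/restrP; exists (nth set0 e (position e P)).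
  by rewrite mem_nth ?(osp_refines_position eA be).
by rewrite (cut P Pb) (osp_neq0 bU).
Qed.

(** Whether the quasi-meet with [e] undoes a merging can be tested on each
    merged block separately, because [restr] commutes with the quasi-meet. *)
Lemma qmeet_unions A s e h : is_osp A s -> is_osp A e ->
  refines (underlying s) (underlying e) -> h \in groupings s ->
  (qmeet (unions h) e == s) = all (fun b => sorted ltn (map (position e) b)) h.
Proof.
move=> sA eA se hs; have hA := osp_unions sA hs.
have piece b : b \in h ->
    (restr e (\bigcup_(P <- b) P) == b) = sorted ltn (map (position e) b).
  move=> bh; have bE := restr_piece sA hs bh; apply: (restr_eq_sorted eA).
    rewrite -{2}bE; apply: is_osp_restr sA _; rewrite (osp_sub hA) //.
    exact: map_f.
  move: se; rewrite !refinesE => /allP se; apply/allP => P Pb; apply: se.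
  move: hs; rewrite mem_groupings => /andP[/eqP <- _].
  by apply/flattenP; exists b.
apply/eqP/allP => [meet b bh|srt].
  rewrite -piece // -{2}(restr_piece sA hs bh) -meet restr_qmeet.
  by rewrite (restr_block hA) ?map_f // qmeetE /= cats0.
have: h \in groupings s by []; rewrite mem_groupings => /andP[/eqP sE _].
rewrite qmeetE -[RHS]sE /unions -map_comp; congr flatten.
rewrite -[RHS]map_id; apply/eq_in_map => b bh /=.
by apply/eqP; rewrite piece // srt.
Qed.

(** The [rho] with quasi-meet [s] lie above [s], since [rho] fixes
    its own quasi-meets; so they are mergings of [s], and [qmeet_unions] tells
    which. *)
Lemma sum_qmeet_fiber (V : nmodType) A s e (F : nat -> V) :
  is_osp A s -> is_osp A e -> refines (underlying s) (underlying e) ->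
  \sum_(rho : OP A | qmeet rho e == s) F (size rho) =
  \sum_(h <- groupings (block_index s e) | all (sorted ltn) h) F (size h).
Proof.
move=> sA eA se.
transitivity
    (\sum_(rho : OP A | op_le s rho && (qmeet rho e == s)) F (size rho)).
  apply: eq_bigl => rho; rewrite andbC; case: eqP => //= rhoe.
  have rhoA := op_blocksP rho.
  by rewrite (op_leE sA rhoA) -{1 2}rhoe qmeetA (qmeet_id rhoA) rhoe eqxx.
rewrite (sum_coarser (fun rho => qmeet rho e == s) (F \o size) sA).
rewrite /block_index -/(position e) groupings_map big_map big_seq_cond.
rewrite [RHS]big_seq_cond; apply: eq_big => [h|h /andP[hs _]] /=;
  last by rewrite !size_map.
by case: (boolP (h \in _)) => //= hs; rewrite (qmeet_unions sA eA) // all_map.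
Qed.

Lemma weisnerE (R : fieldType) A s e :
  is_osp A s -> is_osp A e ->
  weisner R A s e =
  if refines (underlying s) (underlying e) then
    \sum_(h <- groupings (block_index s e) | all (sorted ltn) h)
      (-1) ^+ (size h).-1 / (size h)%:R
  else 0.
Proof.
move=> sA eA; case: ifP => se; last first.
  by apply: big1 => rho /eqP /qmeet_refines /andP[_]; rewrite se.
rewrite -(sum_qmeet_fiber (fun k => (-1) ^+ k.-1 / k%:R) sA eA se).
apply: eq_bigr => rho _; rewrite /mu big_seq1 (osp_restr_id (op_blocksP rho)).
by rewrite subn1.
Qed.

(** Every piece of a union lies in a block of [e], which its position names; the
    union lies in a single block when these names agree. *)
Lemma refines_unions A s e g : is_osp A s -> is_osp A e ->
  refines (underlying s) (underlying e) -> g \in groupings s ->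
  refines (underlying (unions g)) (underlying e) =
  all constant (map (map (position e)) g).
Proof.
move=> sA eA se gs; rewrite refinesE !all_map; apply: eq_in_all => b bg /=.
have bs P : P \in b -> P \in s.
  move: gs; rewrite mem_groupings => /andP[/eqP <- _] Pb.
  by apply/flattenP; exists b.
have: b != [::].
  by apply: contraTneq gs => bE; rewrite mem_groupings -bE bg andbF.
case: b bs {bg} => // P b bs _ /=; rewrite all_map; apply/hasP/allP.
  case=> E /(nthP set0)[j ltj <-]; rewrite bigcup_seq => sub Q Qb /=.
  have pos S : S \in P :: b -> position e S = j.
    move=> Sb; apply/eqP;
      rewrite -(position_nth eA) ?(osp_neq0 sA (bs S Sb)) //.
    by apply: subset_trans sub; apply: bigcup_sup.
  by rewrite !pos // ?mem_head // inE Qb orbT.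
move=> cst; exists (nth set0 e (position e P)).
  by rewrite mem_nth // (osp_refines_position eA se) ?bs ?mem_head.
rewrite bigcup_seq; apply/bigcupsP => Q Qb.
have ltQ := osp_refines_position eA se (bs Q Qb).
suff <- : position e Q = position e P.
  by rewrite (position_nth eA) ?(osp_neq0 sA (bs Q Qb)).
by move: Qb; rewrite inE => /orP[/eqP->|/cst/eqP].
Qed.

Lemma block_index_unions A s e g : is_osp A s -> is_osp A e ->
  refines (underlying s) (underlying e) -> g \in groupings s ->
  refines (underlying (unions g)) (underlying e) ->
  block_index (unions g) e = map (head 0%N) (map (map (position e)) g).
Proof.
move=> sA eA se gs; rewrite refinesE => /allP gE.
rewrite /block_index -!map_comp; apply/eq_in_map => b bg /=.
have: b != [::].
  by apply: contraTneq gs => bE; rewrite mem_groupings -bE bg andbF.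
have /gE/hasP[E /(nthP set0)[j ltj <-] sub] :
  \bigcup_(P <- b) P \in unions g by apply: map_f.
case: b bg sub => // P b bg sub _ /=.
have UP : P \subset \bigcup_(Q <- P :: b) Q by rewrite big_cons subsetUl.
have P0 : P != set0.
  apply: (osp_neq0 sA); move: gs; rewrite mem_groupings => /andP[/eqP <- _].
  by apply/flattenP; exists (P :: b) => //; apply: mem_head.
have U0 : \bigcup_(Q <- P :: b) Q != set0.
  by apply: contraNneq P0 => U0; rewrite -subset0 -U0.
transitivity j; first by apply/eqP; rewrite -(position_nth eA).
by apply/esym/eqP; rewrite -(position_nth eA) // (subset_trans UP).
Qed.

Lemma goldbergE (R : fieldType) A s e :
  is_osp A s -> is_osp A e ->
  goldberg R A s e =
  if refines (underlying s) (underlying e) then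
    \sum_(g <- groupings (block_index s e) | all constant g)
      (\prod_(b <- g) ((size b)`!)%:R)^-1 *
      \sum_(h <- groupings (map (head 0%N) g) | all (sorted ltn) h)
         (-1) ^+ (size h).-1 / (size h)%:R
  else 0.
Proof.
move=> sA eA; rewrite /goldberg.
transitivity (\sum_(rho : OP A | op_le s rho && true)
    zeta R s rho * weisner R A rho e).
  by apply: eq_bigl => rho; rewrite andbT.
rewrite (sum_coarser xpredT (fun rho => zeta R s rho * weisner R A rho e) sA).
case: ifP => se; last first.
  rewrite big_seq; apply: big1 => g gs; rewrite weisnerE ?(osp_unions sA gs) //.
  case: ifP => gE; rewrite ?mulr0 //; case/negP: (negbT se).
  move: gE; rewrite !refinesE => /allP gE; apply/allP => P.
  have := gs; rewrite mem_groupings => /andP[/eqP <- _] /flattenP[b bg Pb].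
  have /gE/hasP[E Ee sub] : \bigcup_(P <- b) P \in unions g by apply: map_f.
  apply/hasP; exists E => //; apply: subset_trans sub.
  by rewrite bigcup_seq (bigcup_sup P).
rewrite /block_index -/(position e) groupings_map big_map.
rewrite [RHS]big_mkcond big_seq [RHS]big_seq; apply: eq_bigr => g gs.
rewrite weisnerE ?(osp_unions sA gs) // (refines_unions sA eA se gs).
case: ifP => [cst|_]; last by rewrite mulr0.
rewrite (block_index_unions sA eA se gs) ?(refines_unions sA eA se gs) //.
congr (_^-1 * _); rewrite /unions !big_map big_seq [RHS]big_seq.
by apply: eq_bigr => b bg; rewrite (restr_piece sA gs bg) size_map.
Qed.

End Weisner.

(** * Sums over increasing and over constant groupings *)

Lemma groupings_consP (X : eqType) (x : X) s g : g \in groupings (x :: s) ->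
  exists b g', g = (x :: b) :: g'.
Proof.
rewrite mem_groupings; case: g => [|[|y b] g] //=; first by rewrite andbF.
by case/andP => /eqP[-> _] _; exists b, g.
Qed.

Lemma des_cons2 a b m : des [:: a, b & m] = ((b < a) + des (b :: m))%N.
Proof.
rewrite /des -!sum1dep_card big_mkcond big_ord_recl /=; congr addn.
by rewrite [RHS]big_mkcond.
Qed.

Lemma asc_cons2 a b m : asc [:: a, b & m] = ((a < b) + asc (b :: m))%N.
Proof.
rewrite /asc -!sum1dep_card big_mkcond big_ord_recl /=; congr addn.
by rewrite [RHS]big_mkcond.
Qed.

Lemma des1 a : des [:: a] = 0%N.
Proof. by rewrite /des -sum1dep_card big_ord0. Qed.

Lemma asc1 a : asc [:: a] = 0%N.
Proof. by rewrite /asc -sum1dep_card big_ord0. Qed.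

Section Increasing.
Variables (R : comNzRingType) (x : R).
Implicit Types (a b : nat) (m : seq nat).

(** The integrand behind a Weisner coefficient: [x] to the power [k-1] stands
    for [(-1)^(k-1)/k], its integral over [[-1, 0]]. *)
Definition increasing_sum m : R :=
  \sum_(h <- groupings m | all (sorted ltn) h) x ^+ (size h).-1.

Lemma increasing_sum1 a : increasing_sum [:: a] = 1.
Proof. by rewrite /increasing_sum big_mkcond /= big_seq1. Qed.

(** A cut between [a] and [b] costs a factor [x] and is always allowed; leaving
    it out is allowed exactly at an ascent. *)
Lemma increasing_sum_cons2 a b m :
  increasing_sum [:: a, b & m] = (x + (a < b)%:R) * increasing_sum (b :: m).
Proof.
rewrite /increasing_sum big_mkcond sum_groupings_cons2.
rewrite big_distrr [RHS]big_mkcond.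
rewrite big_seq [RHS]big_seq; apply: eq_bigr => _ /groupings_consP[c [g ->]] /=.
rewrite exprS; case: (a < b)%N; case: ifP => /= _; rewrite ?addr0 //.
by rewrite mulrDl mul1r.
Qed.

Lemma increasing_sum_nseq_cat a b k m :
  increasing_sum (nseq k.+1 a ++ b :: m) =
  x ^+ k * (x + (a < b)%:R) * increasing_sum (b :: m).
Proof.
elim: k => [|k IH]; first by rewrite increasing_sum_cons2 mul1r.
rewrite increasing_sum_cons2 ltnn addr0.
by rewrite -[a :: _]/(nseq k.+1 a ++ b :: m) IH exprS !mulrA.
Qed.

Lemma increasing_sum_nseq a k : increasing_sum (nseq k.+1 a) = x ^+ k.
Proof.
elim: k => [|k IH]; first exact: increasing_sum1.
by rewrite increasing_sum_cons2 ltnn addr0 [X in _ * X]IH exprS.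
Qed.

Lemma increasing_sum_uniq a m : uniq (a :: m) ->
  increasing_sum (a :: m) = x ^+ des (a :: m) * (x + 1) ^+ asc (a :: m).
Proof.
elim: m a => [|b m IH] a; first by rewrite increasing_sum1 des1 asc1 mul1r.
rewrite increasing_sum_cons2 des_cons2 asc_cons2 cons_uniq inE negb_or.
case/andP => /andP[ab _] /IH->; rewrite !exprD.
case: ltngtP ab => //= _ _; rewrite ?addr0 expr0 expr1 mul1r ?mulrA //.
by rewrite -mulrA mulrCA mulrA.
Qed.

End Increasing.

Section Runs.
Variables (R : numFieldType) (x : R).
Implicit Types (a b : nat) (m : seq nat).

(** A constant group cannot straddle the border between two different values, so
    the groupings on both sides of the border are independent. *)
Lemma sum_constant_run (V : nmodType) a b q m (F : seq (seq nat) -> V) :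
  a != b ->
  \sum_(g <- groupings (nseq q.+1 a ++ b :: m) | all constant g) F g =
  \sum_(g1 <- groupings (nseq q.+1 a))
    \sum_(g2 <- groupings (b :: m) | all constant g2) F (g1 ++ g2).
Proof.
move=> ab; elim: q F => [|q IH] F.
  rewrite big_mkcond sum_groupings_cons2 big_seq1 [RHS]big_mkcond.
  rewrite big_seq [RHS]big_seq; apply: eq_bigr => _ /groupings_consP[c [g ->]].
  by rewrite /= [b == a]eq_sym (negPf ab) addr0.
rewrite big_mkcond sum_groupings_cons2.
transitivity (\sum_(g <- groupings (nseq q.+1 a ++ b :: m) | all constant g)
   (F ([:: a] :: g) + F ((a :: head [::] g) :: behead g))).
  rewrite [RHS]big_mkcond big_seq [RHS]big_seq.
  apply: eq_bigr => _ /groupings_consP[c [g ->]] /=.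
  by rewrite eqxx /=; case: ifP => _; rewrite ?addr0.
rewrite IH sum_groupings_cons2 big_seq [RHS]big_seq.
apply: eq_bigr => _ /groupings_consP[c [g ->]] /=.
by rewrite big_split.
Qed.

Definition weight (X : eqType) (g : seq (seq X)) : R :=
  (\prod_(b <- g) ((size b)`!)%:R)^-1.

(** The contribution of a level run of length [q]. The entry [0] is a
    placeholder, which [run_sumE] moves to any value. *)
Definition run_sum q : R :=
  \sum_(g <- groupings (nseq q 0%N)) weight g * x ^+ (size g).-1.

Definition level_sum m : R :=
  \sum_(g <- groupings m | all constant g)
     weight g * increasing_sum x (map (head 0%N) g).

Lemma groupings_nseq a q g : g \in groupings (nseq q.+1 a) ->
  all constant g /\ map (head 0%N) g = nseq (size g) a.
Proof.
rewrite mem_groupings => /andP[/eqP gE g0]; split.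
  apply/allP => b bg; apply/(constantP 0%N); exists a;
    apply/all_pred1P/allP => y yb.
  have : y \in nseq q.+1 a by rewrite -gE; apply/flattenP; exists b.
  by rewrite mem_nseq.
rewrite -(size_map (head 0%N)); apply/all_pred1P/allP => _ /mapP[b bg ->].
have : b != [::] by apply: contraNneq g0 => <-.
case: b bg => // y b bg _ /=.
have : y \in nseq q.+1 a.
  by rewrite -gE; apply/flattenP; exists (y :: b); rewrite ?mem_head.
by rewrite mem_nseq.
Qed.

Lemma run_sumE a q :
  run_sum q = \sum_(g <- groupings (nseq q a)) weight g * x ^+ (size g).-1.
Proof.
have -> : nseq q a = map (fun=> a) (nseq q 0%N) by rewrite map_nseq.
rewrite groupings_map big_map.
apply: eq_bigr => g _; rewrite size_map /weight big_map.
by congr (_^-1 * _); apply: eq_bigr => b _; rewrite size_map.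
Qed.

(** Induction on the level runs. Merging the first run into [k] blocks leaves
    [k - 1] plateaus, hence the factor [x^(k-1)] of [run_sum], followed by the
    step to the next run, which gives [x] at a descent and [1 + x] at an
    ascent. *)
Lemma level_sum_runs rs : rs != [::] ->
  all (fun r => (r != [::]) && constant r) rs ->
  sorted (fun r r' => head 0%N r != head 0%N r') rs ->
  level_sum (flatten rs) =
  x ^+ des (flatten rs) * (1 + x) ^+ asc (flatten rs) *
  \prod_(r <- rs) run_sum (size r).
Proof.
elim: rs => // r rs IH _ /= /andP[/andP[r0 cr] rsc].
have [q [a ->]] : exists q a, r = nseq q.+1 a.
  have /(constantP 0%N)[a rE] := cr; case: r rE r0 {cr} => // y r rE _.
  by exists (size r), a.
case: rs IH rsc => [|r' rs] IH rsc.
  move=> _; rewrite cats0 big_seq1 size_nseq (run_sumE a) /level_sum.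
  have -> : des (nseq q.+1 a) = 0%N.
    by elim: (q) => [|k IHk]; rewrite ?des1 // des_cons2 ltnn.
  have -> : asc (nseq q.+1 a) = 0%N.
    by elim: (q) => [|k IHk]; rewrite ?asc1 // asc_cons2 ltnn.
  rewrite !mul1r big_mkcond big_seq [RHS]big_seq; apply: eq_bigr => g gs.
  have [-> ->] := groupings_nseq gs.
  by have [c [g' ->]] := groupings_consP gs; rewrite increasing_sum_nseq.
case/andP => ab /(IH isT rsc){IH}; have /andP[/andP[r'0 _] _] := rsc.
case: r' r'0 ab {rsc} => // b r' _ /= ab.
set m := r' ++ flatten rs => IH.
rewrite big_cons -[size (a :: _)]/(size (nseq q.+1 a)) size_nseq (run_sumE a).
rewrite -[a :: nseq q a ++ b :: m]/(nseq q.+1 a ++ b :: m).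
have desE : des (nseq q.+1 a ++ b :: m) = ((b < a) + des (b :: m))%N.
  by elim: (q) => [|k IHk]; rewrite des_cons2 // ltnn add0n.
have ascE : asc (nseq q.+1 a ++ b :: m) = ((a < b) + asc (b :: m))%N.
  by elim: (q) => [|k IHk]; rewrite asc_cons2 // ltnn add0n.
rewrite desE ascE /level_sum (sum_constant_run _ _ _ ab).
transitivity
  ((\sum_(g <- groupings (nseq q.+1 a)) weight g * x ^+ (size g).-1) *
   ((x + (a < b)%:R) * level_sum (b :: m))).
  rewrite big_distrl /= big_seq [RHS]big_seq; apply: eq_bigr => g1 g1s.
  rewrite /level_sum 2!big_distrr /= big_seq_cond [RHS]big_seq_cond.
  apply: eq_bigr => _ /andP[/groupings_consP[c [g2 ->]] _].
  have [_ gh] := groupings_nseq g1s; rewrite map_cat gh /=.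
  have szE : size g1 = (size g1).-1.+1.
    by have [d [g' ->]] := groupings_consP g1s.
  rewrite szE increasing_sum_nseq_cat /weight big_cat invfM /=.
  by rewrite -!mulrA; congr (_ * _); rewrite mulrCA; congr (_ * _);
    rewrite mulrCA.
rewrite IH !exprD.
have -> : x + (a < b)%:R = x ^+ (b < a)%N * (1 + x) ^+ (a < b)%N.
  by case: ltngtP ab => //= _ _;
    rewrite expr0 expr1 ?mulr1 ?mul1r ?addr0 // addrC.
rewrite [LHS]mulrCA -!mulrA; congr (_ * _).
rewrite [RHS]mulrCA; congr (_ * _).
by rewrite [LHS]mulrCA; congr (_ * _); rewrite [LHS]mulrCA.
Qed.

End Runs.

(** * Counting ordered set partitions *)

Section Counting.
Variable T : finType.
Implicit Types (A B : {set T}) (P : {set {set T}}) (s t : seq {set T}).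

Lemma sum_ops_first (V : nmodType) A (F : seq {set T} -> V) : A != set0 ->
  \sum_(s <- ops A) F s =
  \sum_(B : {set T} | (B \subset A) && (B != set0))
     \sum_(s <- ops (A :\: B)) F (B :: s).
Proof.
move=> A0; rewrite big_seq_cond.
rewrite (partition_big (head set0)
  (fun B : {set T} => (B \subset A) && (B != set0))) /=.
  apply: eq_bigr => B /andP[BA B0].
  rewrite -(big_map (cons B) xpredT F) /=.
  transitivity (\sum_(s <- [seq s <- ops A | head set0 s == B]) F s).
    by rewrite big_filter big_seq_cond [RHS]big_seq_cond; apply: eq_bigl => s;
      rewrite andbT andbA andbb.
  apply/perm_big/uniq_perm; first by rewrite filter_uniq ?ops_uniq.
    by rewrite map_inj_uniq ?ops_uniq // => s t [].
  move=> s; rewrite mem_filter mem_ops;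
    apply/andP/mapP => [[/eqP hd sA]|[r rB ->]].
    case: s hd sA => [|B' s] /=; first by rewrite osp_nil (negPf A0).
    move=> ->; rewrite osp_cons => /and3P[_ _ sB].
    by exists s => //; rewrite mem_ops.
  by rewrite osp_cons B0 BA -mem_ops rB eqxx.
case=> [|B s]; rewrite andbT mem_ops; first by rewrite osp_nil (negPf A0).
by rewrite osp_cons => /and3P[-> ->].
Qed.

Lemma sum_nonempty_subsets (V : nmodType) A n (F : nat -> V) : #|A| = n.+1 ->
  \sum_(B : {set T} | (B \subset A) && (B != set0)) F #|B| =
  \sum_(k < n.+1) F k.+1 *+ 'C(n.+1, k.+1).
Proof.
move=> An.
rewrite (partition_big
  (fun B : {set T} => inord #|B|.-1 : 'I_n.+1) xpredT) //=.
apply: eq_bigr => k _.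
have cardE (B : {set T}) :
    (B \subset A) && (B != set0) && (inord #|B|.-1 == k) =
    (B \in [set B : {set T} | B \subset A & #|B| == k.+1]).
  rewrite inE -andbA; apply: andb_id2l => BA; rewrite -card_gt0.
  have leB : (#|B| <= n.+1)%N by rewrite -An subset_leq_card.
  by case: #|B| leB => // c ltc; rewrite -val_eqE /= inordK.
rewrite (eq_bigl _ _ cardE) (eq_bigr (fun=> F k.+1)).
  by rewrite sumr_const cards_draws An.
by move=> B; rewrite inE => /andP[_ /eqP->].
Qed.

(** Choosing the block sizes first, a composition of [#|A|] is realised by a
    multinomial number of ordered set partitions. The proof splits off the first
    block on both sides. *)
Lemma sum_ops_groupings (R : numFieldType) A (F : nat -> R) :
  \sum_(s <- ops A) F (size s) =
  (#|A| `!)%:R * \sum_(g <- groupings (nseq #|A| 0%N)) weight R g * F (size g).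
Proof.
have [n] := ubnP #|A|; elim: n => // n IH in A F *; rewrite ltnS => leAn.
have [->|A0] := eqVneq A set0.
  have -> : \sum_(s <- ops (set0 : {set T})) F (size s) =
      \sum_(s <- [:: [::] : seq {set T}]) F (size s).
    apply/perm_big/uniq_perm; rewrite ?ops_uniq // => s; rewrite mem_ops inE.
    case: s => [|B s]; first by rewrite osp_nil eqxx.
    by rewrite osp_cons subset0; case: eqP.
  by rewrite cards0 !big_seq1 /weight big_nil invr1 !mul1r.
rewrite sum_ops_first //; case An : #|A| => [|m].
  by move/eqP: An; rewrite cards_eq0 (negPf A0).
pose C k := \sum_(g <- groupings (nseq k 0%N)) weight R g * F (size g).+1.
rewrite (eq_bigr (fun B : {set T} =>
  ((m.+1 - #|B|)`!)%:R * C (m.+1 - #|B|)%N)); last first.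
  move=> B /andP[BA B0]; have cB : #|A :\: B| = (m.+1 - #|B|)%N.
    by rewrite cardsD (setIidPr BA) An.
  rewrite (IH _ (fun k => F k.+1)) cB // -An.
  apply: leq_trans leAn; rewrite -subSn ?subset_leq_card // leq_subLR.
  by rewrite addnC -addn1 leq_add2l card_gt0.
rewrite (sum_nonempty_subsets (fun k => ((m.+1 - k)`!)%:R * C (m.+1 - k)%N) An).
rewrite sum_groupings_first mulr_sumr size_nseq; apply: eq_bigr => i _.
rewrite drop_nseq subSS.
have -> : \sum_(g <- groupings (nseq (m - i) 0%N))
    weight R ((0%N :: take i (nseq m 0%N)) :: g) *
    F (size ((0%N :: take i (nseq m 0%N)) :: g)) = (i.+1`!%:R)^-1 * C (m - i)%N.
  rewrite /C mulr_sumr; apply: eq_bigr => g _.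
  rewrite /weight big_cons invfM -mulrA; congr (_^-1 * _).
  by rewrite [size (_ :: _)]/= size_takel // size_nseq -ltnS ltn_ord.
have f0 : (i.+1`!%:R : R) != 0 by rewrite pnatr_eq0 -lt0n fact_gt0.
rewrite -(bin_fact (ltn_ord i)) subSS mulrA [('C(_, _) * _)%N]mulnCA natrM.
by rewrite [X in _ = X * _]mulrC mulKf // natrM -mulrA !mulr_natl.
Qed.

Lemma osp_underlying A s : is_osp A s -> partition (underlying s) A.
Proof.
move=> sA; apply/and3P; split.
- rewrite /cover -(osp_bigcup sA) bigcup_seq; apply/eqP/eq_bigl => B.
  by rewrite inE.
- by apply/trivIsetP => B C; rewrite !inE; apply: osp_disjoint sA _ _.
- by rewrite inE; apply: osp_notin0 sA.
Qed.

Lemma osp_perm_enum A P s : partition P A ->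
  is_osp A s && (underlying s == P) = perm_eq s (enum P).
Proof.
move=> /and3P[/eqP PA PI P0]; apply/andP/idP => [[sA /eqP <-]|sP].
  apply: uniq_perm; rewrite ?enum_uniq ?(osp_uniq sA) // => B.
  by rewrite mem_enum inE.
have su : uniq s by rewrite (perm_uniq sP) enum_uniq.
have memE : s =i P by move=> B; rewrite (perm_mem sP) mem_enum.
split; last by apply/eqP/setP => B; rewrite inE memE.
apply/and3P; split; first by rewrite memE.
  apply/(pairwiseP set0) => i j lti ltj ij; apply: (trivIsetP PI).
  - by rewrite -memE mem_nth.
  - by rewrite -memE mem_nth.
  by rewrite nth_uniq // ltn_eqF.
by rewrite -PA bigcup_seq; apply/eqP/eq_bigl.
Qed.

(** The orderings of a set partition are the permutations of its blocks. *)
Lemma sum_ops_partitions (V : nmodType) A (F : nat -> V) :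
  \sum_(s <- ops A) F (size s) =
  \sum_(P | partition P A) F #|P| *+ #|P| `!.
Proof.
rewrite big_seq_cond.
rewrite (partition_big (@underlying T) (fun P => partition P A)) /=.
  apply: eq_bigr => P PA.
  transitivity (\sum_(s <- permutations (enum P)) F #|P|).
    rewrite -big_filter.
    transitivity (\sum_(s <- permutations (enum P)) F (size s)).
      apply/perm_big/uniq_perm;
        rewrite ?permutations_uniq ?filter_uniq ?ops_uniq //.
      move=> s; rewrite mem_filter andbT mem_permutations -(osp_perm_enum _ PA).
      by rewrite mem_ops andbC andbA andbb.
    rewrite big_seq [RHS]big_seq; apply: eq_bigr => s.
    by rewrite mem_permutations => /perm_size->; rewrite -cardE.
  rewrite big_const_seq count_predT size_permutations ?enum_uniq //.
  by rewrite -cardE iter_addr_0.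
by move=> s; rewrite andbT mem_ops; apply: osp_underlying.
Qed.

End Counting.

Section Stirling.

Lemma sum_ops_stirling2 (R : comNzRingType) q (F : nat -> R) : (0 < q)%N ->
  \sum_(s <- ops [set: 'I_q]) F (size s) =
  \sum_(1 <= k < q.+1) (k`! * stirling2 q k)%:R * F k.
Proof.
case: q => // q _; rewrite sum_ops_partitions big_add1 big_mkord.
have cardP (P : {set {set 'I_q.+1}}) :
    partition P [set: 'I_q.+1] -> (0 < #|P| <= q.+1)%N.
  move=> PA; have := card_partition PA; rewrite cardsT card_ord => qE.
  have /and3P[_ _ P0] := PA; rewrite lt0n; apply/andP; split.
    by apply/negP => /eqP/cards0_eq PE; move: qE; rewrite PE big_set0.
  rewrite [X in (_ <= X)%N]qE -sum1_card leq_sum // => B BP; rewrite card_gt0.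
  by apply: contraNneq P0 => <-.
rewrite (partition_big
  (fun P : {set {set 'I_q.+1}} => inord #|P|.-1 : 'I_q.+1) xpredT) //=.
apply: eq_bigr => k _; rewrite mulr_natl.
have PE (P : {set {set 'I_q.+1}}) :
    partition P [set: 'I_q.+1] && (inord #|P|.-1 == k) =
    (P \in [set P | partition P [set: 'I_q.+1] & #|P| == k.+1]).
  rewrite inE; apply: andb_id2l => /cardP; case: #|P| => // c /= ltc.
  by rewrite -val_eqE /= inordK.
rewrite (eq_bigl _ _ PE) (eq_bigr (fun=> F k.+1 *+ (k.+1)`!)).
  by rewrite sumr_const -mulrnA.
by move=> P; rewrite inE => /andP[_ /eqP->].
Qed.

Lemma PpolyE (R : comNzRingType) q (x : R) : (0 < q)%N ->
  Ppoly q x = \sum_(s <- ops [set: 'I_q]) x ^+ (size s).-1.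
Proof. by move=> q0; rewrite (sum_ops_stirling2 (fun k => x ^+ k.-1)). Qed.

Lemma run_sum_Ppoly (R : numFieldType) q (x : R) : (0 < q)%N ->
  run_sum x q = (q`!%:R)^-1 * Ppoly q x.
Proof.
move=> q0; rewrite (PpolyE _ q0) (sum_ops_groupings _ (fun k => x ^+ k.-1)).
by rewrite cardsT card_ord mulKf // pnatr_eq0 -lt0n fact_gt0.
Qed.

End Stirling.

(** * Eulerian polynomials *)

Section Eulerian.
Variable q : nat.
Implicit Type w : 'S_q.

Definition singletons w : seq {set 'I_q} := [seq [set w i] | i <- enum 'I_q].

Lemma osp_singletons w : is_osp [set: 'I_q] (singletons w).
Proof.
apply/and3P; split.
- by apply/mapP => -[i _ /setP/(_ (w i))]; rewrite !inE eqxx.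
- apply/(pairwiseP set0) => i j; rewrite !inE size_map => lti ltj ij.
  have i0 : 'I_q by apply: (@Ordinal q i); rewrite -[q]size_enum_ord.
  rewrite (nth_map i0 _ _ lti) (nth_map i0 _ _ ltj) disjoints1 inE.
  by rewrite (inj_eq perm_inj) nth_uniq ?enum_uniq // ltn_eqF.
apply/eqP/setP => i; rewrite inE bigcup_seq; apply/bigcupP; exists [set i];
  last by rewrite inE.
by apply/mapP; exists (w^-1%g i); rewrite ?mem_enum ?permKV.
Qed.

Lemma block_index_singletons w :
  block_index (singletons w) (singletons 1%g) = one_line w.
Proof.
rewrite /block_index -map_comp; apply/eq_map => i /=; apply/eqP.
rewrite -/(position _ _) -(position_nth (osp_singletons 1%g)).
- by rewrite (nth_map i) ?size_enum_ord // nth_ord_enum perm1.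
- by apply/set0Pn; exists (w i); rewrite inE.
by rewrite size_map size_enum_ord.
Qed.

(** Meeting with a partition into singletons leaves only singletons, so the
    result is a rearrangement of all of them. *)
Lemma qmeet_singletons (rho : OP [set: 'I_q]) :
  exists w, qmeet rho (singletons 1%g) = singletons w.
Proof.
have tA : is_osp [set: 'I_q] (qmeet rho (singletons 1%g)).
  exact: osp_qmeet (op_blocksP rho) (osp_singletons _) _.
have /andP[_] := qmeet_refines (erefl (qmeet rho (singletons 1%g))).
set t := qmeet _ _ in tA *; rewrite refinesE => /allP t1.
have [L tE] : exists L, t = [seq [set i] | i <- L].
  elim: (t) t1 (osp_notin0 tA) => [|B s IH] sub; first by exists [::].
  rewrite inE negb_or eq_sym => /andP[B0 s0].
  have [|L sE] := IH _ s0.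
    by move=> C Cs; apply: sub; rewrite inE Cs orbT.
  have /hasP[_ /mapP[i _ ->]] := sub B (mem_head _ _).
  rewrite subset1 (negPf B0) orbF perm1 => /eqP->.
  by exists (i :: L); rewrite sE.
have /tuple_permP[w LE] : perm_eq L (ord_tuple q).
  apply: uniq_perm; rewrite ?enum_uniq //.
    by move: (osp_uniq tA); rewrite tE => /map_uniq.
  move=> i; rewrite mem_enum; have := osp_bigcup tA => /setP/(_ i).
  rewrite tE bigcup_seq !inE => /bigcupP[_ /mapP[j jL ->]].
  by rewrite inE => /eqP->.
exists w; rewrite tE LE -map_comp; apply: eq_map => i /=.
by rewrite tnth_ord_tuple.
Qed.

Lemma singletons_inj : injective singletons.
Proof.
move=> v w eqvw; apply/permP => i.
have /eq_in_map/(_ i) := eqvw; rewrite mem_enum => /(_ isT).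
exact: set1_inj.
Qed.

(** The ordered set partitions are grouped by the permutation that their
    quasi-meet with the increasing list of singletons produces. *)
Lemma eulerianE (R : comNzRingType) (x : R) : (0 < q)%N ->
  eulerian q x (x + 1) = \sum_(s <- ops [set: 'I_q]) x ^+ (size s).-1.
Proof.
move=> q0; rewrite -(sum_ops _ xpredT (fun s => x ^+ (size s).-1)).
transitivity (\sum_w \sum_(rho : OP [set: 'I_q] |
    qmeet rho (singletons 1%g) == singletons w) x ^+ (size rho).-1).
  apply: eq_bigr => w _.
  rewrite (sum_qmeet_fiber (fun k => x ^+ k.-1)
    (osp_singletons w) (osp_singletons _)).
    rewrite block_index_singletons -/(increasing_sum x (one_line w)).
    have: one_line w != [::] by rewrite -size_eq0 size_map size_enum_ord -lt0n.
    have : uniq (one_line w).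
      by rewrite (map_inj_uniq (f := fun i => val (w i))) ?enum_uniq // =>
        i j /val_inj/perm_inj.
    by case: (one_line w) => // a m /(increasing_sum_uniq x)->.
  rewrite refinesE; apply/allP => _ /mapP[i _ ->]; apply/hasP;
    exists [set w i] => //.
  by apply/mapP; exists (w i); rewrite ?mem_enum ?perm1.
rewrite (exchange_big_dep xpredT) //=; apply: eq_bigr => rho _.
have [w ->] := qmeet_singletons rho.
rewrite (big_pred1 w) // => v; rewrite eq_sym; exact: inj_eq singletons_inj _ _.
Qed.

End Eulerian.

(** * Partitioned Goldberg coefficients *)

Section Factorization.
Variable T : finType.
Implicit Types (A B P Q U : {set T}) (s t e p r : seq {set T}).

Lemma qmeet_sub s P : set0 \notin s -> {in s, forall Q, Q \subset P} ->
  qmeet s [:: P] = s.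
Proof.
elim: s => //= Q s IH; rewrite inE negb_or eq_sym => /andP[Q0 s0] sub.
rewrite qmeet_cons IH // => [|S Ss]; last by apply: sub; rewrite inE Ss orbT.
by rewrite /restr /= (setIidPl (sub Q _)) ?mem_head // Q0.
Qed.

(** The left regular band law [x y x = x y] with [x] the one-block sequence
    [P]. *)
Lemma restr_qmeet_mid s t P :
  restr (qmeet s t) P = qmeet (restr s P) (restr t P).
Proof.
have restrE u : restr u P = qmeet [:: P] u by rewrite qmeetE /= cats0.
rewrite restr_qmeet [restr t P]restrE qmeetA qmeet_sub //.
  by rewrite mem_filter eqxx.
by move=> Q; apply: in_restr_sub.
Qed.

Section ProductFormula.
Variable R : fieldType.

(** For each [s] the quasi-meet with [e] is the only index of the outer sum to
    which [s] contributes. *)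
Lemma pgoldberg_single_sum A t e p : is_osp A t -> is_osp A e -> is_osp A p ->
  pgoldberg R A t e p =
  \sum_(s <- ops A | (qmeet (qmeet s e) t == t) && (qmeet p s == s))
     zeta R t (qmeet s e) * mu R s p.
Proof.
move=> tA eA pA; rewrite -(sum_ops _
  (fun s => (qmeet (qmeet s e) t == t) && (qmeet p s == s))
  (fun s => zeta R t (qmeet s e) * mu R s p)).
rewrite /pgoldberg /pweisner; under eq_bigr do rewrite mulr_sumr.
rewrite (exchange_big_dep (fun rho : OP A => op_le rho p)) /=; last first.
  by move=> sigma rho _ /andP[].
rewrite big_mkcond [RHS]big_mkcond; apply: eq_bigr => rho _.
have rhoA := op_blocksP rho.
have [sigma sigmaE] := exists_OP (osp_qmeet rhoA eA (subxx _)).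
rewrite -(op_leE rhoA pA); case: (op_le rho p); last by rewrite andbF.
rewrite andbT -sigmaE -(op_leE tA (op_blocksP sigma)).
rewrite (eq_bigl (fun sigma' => (sigma' == sigma) && op_le t sigma)).
  by case: (op_le t sigma);
    [under eq_bigl do rewrite andbT|under eq_bigl do rewrite andbF];
    rewrite ?big_pred1_eq ?big_pred0_eq.
move=> sigma'; rewrite andbT andbC.
have -> : (op_blocks sigma == op_blocks sigma' :> seq {set T}) =
    (sigma' == sigma).
  by rewrite eq_sym.
by case: eqP => // ->.
Qed.

Lemma goldberg_pgoldberg A t e : A != set0 -> is_osp A t ->
  goldberg R A t e = pgoldberg R A t e (one_block A).
Proof.
move=> A0 tA; apply: eq_bigr => sigma _; congr (_ * _); apply: eq_bigl => rho.
have rhoA := op_blocksP rho; rewrite (op_leE rhoA (is_osp_one_block A0)).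
rewrite [qmeet (one_block A) _]qmeetE /= cats0 (osp_restr_id rhoA).
by rewrite eqxx andbT.
Qed.

(** The [s] below [p] are the concatenations of one ordered set partition of
    each block of [p], so a product of functions of the restrictions sums to the
    product of the sums. *)
Lemma sum_ops_below A p (f : {set T} -> seq {set T} -> R) : is_osp A p ->
  \sum_(s <- ops A | qmeet p s == s) \prod_(P <- p) f P (restr s P) =
  \prod_(P <- p) \sum_(s <- ops P) f P s.
Proof.
elim: p A => [|P p IH] A pA.
  move: pA; rewrite osp_nil => /eqP->; rewrite big_nil.
  transitivity (\sum_(s <- [:: [::] : seq {set T}]) (1 : R));
    last by rewrite big_seq1.
  rewrite -big_filter; under eq_bigr do rewrite big_nil.
  apply/perm_big/uniq_perm; rewrite ?filter_uniq ?ops_uniq // => s.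
  rewrite mem_filter mem_ops inE; case: s => [|B s];
    first by rewrite osp_nil eqxx.
  by rewrite osp_cons subset0; case: (B == set0); rewrite andbF.
move: (pA); rewrite osp_cons => /and3P[P0 PA pB]; set B := A :\: P in pB.
have dis s : is_osp B s -> {in s, forall Q, [disjoint Q & P]}.
  by move=> sB Q /(osp_sub sB); rewrite subsetD => /andP[].
have rest r s : is_osp P r -> is_osp B s ->
    {in p, forall Q, restr (r ++ s) Q = restr s Q}.
  move=> rP sB Q Qp; rewrite restr_cat [restr r Q]restr_disjoint // =>
    S /(osp_sub rP) SP.
  by apply: disjointWl SP _; rewrite disjoint_sym; apply: dis pB _ Qp.
have head r s : is_osp P r -> is_osp B s -> restr (r ++ s) P = r.
  move=> rP sB; rewrite restr_cat (osp_restr_id rP) restr_disjoint ?cats0 //.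
  exact: dis.
have tail r s : is_osp P r -> is_osp B s -> qmeet p (r ++ s) = qmeet p s.
  move=> rP sB; rewrite !qmeetE; congr flatten; apply/eq_in_map => Q Qp.
  exact: rest rP sB Q Qp.
transitivity (\sum_(s <- [seq r ++ s |
    r <- ops P, s <- [seq s <- ops B | qmeet p s == s]])
   \prod_(Q <- P :: p) f Q (restr s Q)).
  rewrite -big_filter; apply/perm_big/uniq_perm;
    first by rewrite filter_uniq ?ops_uniq.
    apply: allpairs_uniq; rewrite ?filter_uniq ?ops_uniq //.
    move=> [r s] [r' s'] /allpairsP[[r1 s1] [/= r1P s1B [-> ->]]].
    move=> /allpairsP[[r2 s2] [/= r2P s2B [-> ->]]] eq12.
    move: r1P s1B r2P s2B; rewrite !mem_filter !mem_ops.
    move=> r1P /andP[_ s1B] r2P /andP[_ s2B].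
    have r12 : r1 = r2 by rewrite -(head _ _ r1P s1B) eq12 head.
    by move: eq12; rewrite r12 => /eqP; rewrite eqseq_cat // eqxx => /eqP->.
  move=> s; rewrite mem_filter mem_ops; apply/andP/allpairsP => [[/eqP sE sA]|].
    exists (restr s P, qmeet p s);
      rewrite /= mem_filter !mem_ops -qmeet_cons sE.
    rewrite qmeetA (qmeet_id pB) eqxx (is_osp_restr sA PA) /=; split=> //.
    exact: osp_qmeet pB sA (subsetDl _ _).
  case=> -[r u] /= [+ + ->];
    rewrite mem_filter !mem_ops => rP /andP[/eqP uE uB].
  rewrite qmeet_cons (head _ _ rP uB) (tail _ _ rP uB) uE eqxx; split=> //.
  by rewrite osp_cat !(osp_bigcup rP) PA rP uB.
rewrite big_allpairs_dep big_cons -(IH B pB) mulr_suml.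
rewrite big_seq [RHS]big_seq; apply: eq_bigr => r; rewrite mem_ops => rP.
rewrite mulr_sumr big_filter big_seq_cond [RHS]big_seq_cond;
  apply: eq_bigr => s.
rewrite mem_ops => /andP[sB _]; rewrite big_cons (head _ _ rP sB);
  congr (_ * _).
by rewrite big_seq [RHS]big_seq; apply: eq_bigr => Q Qp;
  rewrite (rest _ _ rP sB Q Qp).
Qed.

Lemma zeta_factor t s p : qmeet p s = s ->
  zeta R t s = \prod_(P <- p) zeta R (restr t P) (restr s P).
Proof.
move=> ps; rewrite prodfV; congr (_^-1);
  rewrite -{1}ps qmeetE big_flatten big_map.
apply: eq_bigr => P _; rewrite big_seq [RHS]big_seq; apply: eq_bigr => B.
by move=> /in_restr_sub /setIidPr BP; rewrite restr_restr BP.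
Qed.

(** The sign splits because each restriction to a block of [p] has at least one
    block, which keeps the subtractions of natural numbers exact. *)
Lemma mu_factor A s p : is_osp A s -> is_osp A p -> qmeet p s = s ->
  mu R s p = \prod_(P <- p) mu R (restr s P) (one_block P).
Proof.
move=> sA pA ps; rewrite /mu prodf_div; congr (_ / _); last first.
  by apply: eq_bigr => P _; rewrite big_seq1 restr_restr setIid.
rewrite prodrXr; congr (_ ^+ _).
rewrite -{1}ps qmeetE size_flatten /shape -map_comp sumnE big_map.
rewrite -[size p]sum1_size big_seq [X in (_ - X)%N]big_seq [RHS]big_seq.
rewrite -sumnB // => P Pp /=.
have := osp_bigcup (is_osp_restr sA (osp_sub pA Pp)).
case: (restr s P) => //; rewrite big_nil => P0.
by have := osp_neq0 pA Pp; rewrite -P0 eqxx.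
Qed.

(** The condition that [qmeet s e] fixes [t] can be checked on restrictions to
    the blocks of [p]: both sides are fixed by [p], hence are the concatenations
    of their restrictions. *)
Lemma pgoldberg_factor A t e p : is_osp A t -> is_osp A e -> is_osp A p ->
  pgoldberg R A t e p =
  if refines (underlying t) (underlying e) && op_le t p then
    \prod_(P <- p) goldberg R P (restr t P) (restr e P)
  else 0.
Proof.
move=> tA eA pA; rewrite pgoldberg_single_sum // (op_leE tA pA).
case: ifP => [/andP[_ /eqP pt]|nle]; last first.
  apply: big_pred0 => s; apply/negbTE/negP => /andP[/eqP fix_t /eqP ps].
  case/negP: (negbT nle); apply/andP; split; last first.
    by rewrite -{1}fix_t 2!qmeetA ps fix_t.
  have /andP[+ _] := qmeet_refines fix_t.
  have /andP[_ +] := qmeet_refines (erefl (qmeet s e)).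
  rewrite !refinesE => /allP se_e /allP t_se; apply/allP => B /t_se/hasP[C].
  by move=> /se_e/hasP[E Ee CE] BC; apply/hasP; exists E;
    rewrite // (subset_trans BC).
pose f P r := if qmeet (qmeet r (restr e P)) (restr t P) == restr t P then
  zeta R (restr t P) (qmeet r (restr e P)) * mu R r (one_block P) else 0.
transitivity (\prod_(P <- p) \sum_(s <- ops P) f P s); last first.
  rewrite big_seq [RHS]big_seq; apply: eq_bigr => P Pp.
  have P0 := osp_neq0 pA Pp; have PA := osp_sub pA Pp.
  have tP := is_osp_restr tA PA; have eP := is_osp_restr eA PA.
  rewrite goldberg_pgoldberg // pgoldberg_single_sum //;
    last exact: is_osp_one_block.
  rewrite [RHS]big_mkcond big_seq [RHS]big_seq; apply: eq_bigr => r;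
    rewrite mem_ops => rP.
  rewrite [qmeet (one_block P) r]qmeetE /= cats0 (osp_restr_id rP).
  by rewrite eqxx andbT.
rewrite -(sum_ops_below f pA) big_mkcondl.
rewrite big_seq_cond [RHS]big_seq_cond.
apply: eq_bigr => s /andP[]; rewrite mem_ops => sA /eqP ps.
have restr3 P : qmeet (qmeet (restr s P) (restr e P)) (restr t P)
    = restr (qmeet (qmeet s e) t) P by rewrite -!restr_qmeet_mid.
have pse : qmeet p (qmeet s e) = qmeet s e by rewrite qmeetA ps.
case: eqP => [fix_t|/eqP fix_t]; last first.
  apply/esym/eqP; rewrite prodf_seq_eq0 /=; apply: contraR fix_t.
  rewrite -all_predC => /allP all_eq; rewrite -pse -qmeetA -[X in _ == X]pt.
  rewrite [qmeet p _]qmeetE [qmeet p t]qmeetE.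
  apply/eqP; congr flatten; apply/eq_in_map => P /all_eq /=; rewrite /f restr3.
  by case: ifP => [/eqP //|_]; rewrite eqxx.
rewrite (zeta_factor t pse) (mu_factor sA pA ps) -big_split.
by apply: eq_bigr => P _; rewrite /f restr3 fix_t eqxx restr_qmeet_mid.
Qed.

End ProductFormula.

End Factorization.

(** * The integral formula *)

Section Integral.
Variable R : realType.

Lemma Rintegral_deriv (p : {poly R}) (a b : R) : a < b ->
  \int[lebesgue_measure]_(x in `[a, b]%classic) p^`().[x] = p.[b] - p.[a].
Proof.
move=> ab; rewrite /Rintegral (@continuous_FTC2 _ (horner p^`()) (horner p)) //.
- exact/continuous_subspaceT/continuous_horner.
- split=> [x _||]; first exact: derivable_horner.
    by apply: cvg_at_right_filter; apply: continuous_horner.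
  by apply: cvg_at_left_filter; apply: continuous_horner.
by move=> x _; rewrite derivE.
Qed.

Lemma Rintegral_sum_powers (I : Type) (r : seq I) (c : I -> R) (k : I -> nat) :
  \int[lebesgue_measure]_(x in `[-1, 0]%classic)
    (\sum_(i <- r) c i * x ^+ k i) =
  \sum_(i <- r) c i * ((-1) ^+ k i / (k i).+1%:R) :> R.
Proof.
pose p : {poly R} := \sum_(i <- r) (c i / (k i).+1%:R) *: 'X^((k i).+1).
have dp : p^`() = \sum_(i <- r) c i *: 'X^(k i).
  rewrite (big_morph _ (@derivD R) (@deriv0 R)); apply: eq_bigr => i _.
  rewrite derivZ derivXn -scalerMnr scalerMnl.
  by rewrite -[_ *+ _]mulr_natr divfK ?pnatr_eq0.
transitivity (\int[lebesgue_measure]_(x in `[-1, 0]%classic) p^`().[x]).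
  apply: eq_Rintegral => x _; rewrite dp horner_sum.
  by apply: eq_bigr => i _; rewrite !hornerE.
rewrite Rintegral_deriv ?ltrN10 // /p !horner_sum -sumrB; apply: eq_bigr => i _.
rewrite !hornerE exprS mul0r mulr0 sub0r exprS mulN1r mulrN opprK.
exact: mulrAC.
Qed.

(** The sum over pairs of groupings of [goldbergE] has the same terms as the
    expansion of the integrand, with [(-1)^k/(k+1)] in place of [x^k]. *)
Lemma goldberg_integral (n : nat) (tau eta : OPn n) : (0 < n)%N ->
  goldbergn R n tau eta =
  if refines (underlying tau) (underlying eta) then
    let q := run_lengths (block_index tau eta) in
    (\prod_(qj <- q) (qj`!)%:R)^-1 *
    \int[lebesgue_measure]_(x in `[-1, 0]%classic)
       (x ^+ des_eta eta tau * (1 + x) ^+ asc_eta eta tau *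
        \prod_(qj <- q) Ppoly qj x)
  else 0.
Proof.
move=> n_gt0; have tauA := op_blocksP tau; have etaA := op_blocksP eta.
rewrite (goldbergE R tauA etaA); case: ifP => // _.
rewrite /des_eta /asc_eta; set m := block_index tau eta => /=.
have m0 : m != [::].
  rewrite -size_eq0 size_map size_eq0; apply: contraTneq n_gt0 => tau0.
  move: tauA; rewrite tau0 osp_nil => /eqP/setP A0.
  by case: (n) A0 => // k /(_ ord0); rewrite !inE.
set Q := \prod_(qj <- _) _.
have Q0 : Q != 0.
  by rewrite /Q prodf_seq_neq0; apply/allP => k _;
    rewrite pnatr_eq0 -lt0n fact_gt0.
pose L := [seq (g, h) | g <- [seq g <- groupings m | all constant g],
  h <- [seq h <- groupings (map (head 0%N) g) | all (sorted ltn) h]].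
transitivity (Q^-1 * \sum_(gh <- L) (Q * weight R gh.1) *
    ((-1) ^+ (size gh.2).-1 / (size gh.2).-1.+1%:R)).
  rewrite big_allpairs_dep big_filter mulr_sumr big_seq_cond [RHS]big_seq_cond.
  apply: eq_bigr => g /andP[gm _] /=; rewrite big_filter !mulr_sumr.
  rewrite big_seq_cond [RHS]big_seq_cond; apply: eq_bigr => h /andP[hg _].
  rewrite -[Q * _ * _]mulrA mulKf //; congr (_ * (_ / _%:R)); rewrite prednK //.
  case: (m) m0 gm => // a m' _ /groupings_consP[b [g' gE]].
  by move: hg; rewrite gE /= => /groupings_consP[c [h' ->]].
congr (_ * _); rewrite -Rintegral_sum_powers; apply: eq_Rintegral => x _.
have -> : \sum_(gh <- L) Q * weight R gh.1 * x ^+ (size gh.2).-1 =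
    Q * level_sum x m.
  rewrite big_allpairs_dep big_filter mulr_sumr; apply: eq_bigr => g _.
  by rewrite big_filter /increasing_sum !mulr_sumr; apply: eq_bigr => h _;
    rewrite mulrA.
have [mE runs srt] := level_runsP m.
rewrite -{1}mE level_sum_runs // ?mE; last first.
  by apply: contraNneq m0 => r0; rewrite -mE r0.
rewrite mulrCA; congr (_ * _); rewrite /Q /run_lengths !big_map -big_split.
rewrite big_seq [RHS]big_seq; apply: eq_bigr => r /(allP runs)/andP[r0 _] /=.
by rewrite run_sum_Ppoly ?lt0n ?size_eq0 // mulVKf // pnatr_eq0 -lt0n fact_gt0.
Qed.

End Integral.

Theorem proposition5p21 (R : realType) (n : nat) (n_gt0 : (0 < n)%N) :
  [/\ forall tau eta : OPn n,
        goldbergn R n tau eta =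
        if refines (underlying tau) (underlying eta) then
          let q := run_lengths (block_index tau eta) in
          (\prod_(qj <- q) (qj`!)%:R)^-1 *
          \int[lebesgue_measure]_(x in `[-1, 0]%classic)
             (x ^+ des_eta eta tau * (1 + x) ^+ asc_eta eta tau *
              \prod_(qj <- q) Ppoly qj x)
        else 0,
      forall (q : nat) (x : R), (0 < q)%N -> Ppoly q x = eulerian q x (x + 1)
    & forall tau eta pi : OPn n,
        pgoldbergn R n tau eta pi =
        if refines (underlying tau) (underlying eta) && op_le tau pi then
          \prod_(P <- pi) goldberg R P (restr tau P) (restr eta P)
        else 0].
Proof.
split=> [tau eta|q x q_gt0|tau eta pi].
- exact: goldberg_integral.
- by rewrite PpolyE // eulerianE.
- exact: pgoldberg_factor (op_blocksP tau) (op_blocksP eta) (op_blocksP pi).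
Qed.
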